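(* Let $(M,c)$ be a space- and time-oriented connected conformal spin manifold of signature $(p,q)$, $n=p+q\ge3$. Let $\alpha\in\Omega^{k+1}_{\mathcal{T}}(M)$ be a parallel tractor $(k+1)$-form, $0\le k\le n$, and $\psi\in\Gamma(\mathcal{S}(M))$ a parallel spin tractor. For given $g\in c$ let $(\alpha_+,\alpha_0,\alpha_\mp,\alpha_-)$ be the components of $\alpha$ with respect to $g$, with $\alpha_+\in\Omega^k_{nc,g}(M)$, and let $\psi$ correspond via $g$ to $(\varphi,-\frac1nD^g\varphi)$ with $\varphi\in\ker P^g$. Then the twistor spinor corresponding via $g$ to the parallel spin tractor $\alpha\cdot\psi$ is $$\alpha_+\circ\varphi:=\widetilde\Phi^g(proj^g_+(\alpha\cdot\psi))=\frac2n\,\alpha_+\cdot D^g\varphi+(-1)^{k+1}\alpha_\mp\cdot\varphi+(-1)^{k+1}\alpha_0\cdot\varphi$$ $$=\frac2n\,\alpha_+\cdot D^g\varphi+\frac{(-1)^k}{n-k+1}\,d^*\alpha_+\cdot\varphi+\frac{(-1)^{k+1}}{k+1}\,d\alpha_+\cdot\varphi\ \in\ \ker P^g .$$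
   Context: Clifford convention: $X\cdot Y+Y\cdot X=-2\langle X,Y\rangle$; a form acts on spinors by $\sum_{i_1<\dots<i_r}\omega_{i_1\dots i_r}e^\flat_{i_1}\wedge\dots\wedge e^\flat_{i_r}\mapsto\sum\omega_{i_1\dots i_r}e_{i_1}\cdots e_{i_r}\cdot$ for a pseudo-orthonormal basis $(e_i)$, $e_i^\flat=\langle e_i,\cdot\rangle$. Tractors: $\mathcal{T}(M)$ is the standard tractor bundle of $(M,c)$ (associated to the normal conformal Cartan geometry of type $(SO^+(p+1,q+1),P)$, $P$ the stabilizer of an isotropic ray) with tractor metric of signature $(p+1,q+1)$ and normal conformal tractor connection $\nabla^{nc}$; $\Omega^{k+1}_{\mathcal{T}}(M)$ denotes sections of $\Lambda^{k+1}\mathcal{T}(M)^*$; $\mathcal{S}(M)$ is the spin tractor bundle with fibre the spinor module $\Delta_{p+1,q+1}$, with fibrewise Clifford action and induced connection. ''Parallel'' means $\nabla^{nc}$-parallel. Metric description: $g\in c$ gives $\mathcal{T}(M)\cong\underline{\mathbb{R}}\oplus TM\oplus\underline{\mathbb{R}}$, $(a,Y,b)=as_-+Y+bs_+$, with metric $a_1b_2+a_2b_1+g(Y_1,Y_2)$ and $\nabla^{nc}_X(a,Y,b)=(X(a)+K^g(X,Y),\nabla^g_XY+aX-bK^g(X)^\sharp,X(b)-g(X,Y))$, where $K^g=\frac{1}{n-2}(\frac{scal^g}{2(n-1)}g-Ric^g)$. A tractor $(k+1)$-form decomposes uniquely as $\alpha=s_+^\flat\wedge\alpha_++\alpha_0+s_-^\flat\wedge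 s_+^\flat\wedge\alpha_\mp+s_-^\flat\wedge\alpha_-$ with $\alpha_\pm\in\Omega^k(M)$, $\alpha_0\in\Omega^{k+1}(M)$, $\alpha_\mp\in\Omega^{k-1}(M)$. If $\alpha$ is parallel then $\alpha_0=\frac1{k+1}d\alpha_+$ and $\alpha_\mp=-\frac1{n-k+1}d^*\alpha_+$ (with $d^*=-\sum_i\epsilon_i\,s_i\lrcorner\nabla^g_{s_i}$ for a local pseudo-orthonormal frame $(s_i)$, $\epsilon_i=g(s_i,s_i)$); the forms $\alpha_+$ arising from parallel $\alpha$ are the normal conformal (nc-)Killing $k$-forms, forming the space $\Omega^k_{nc,g}(M)$. Further $g$ gives $\mathcal{S}(M)\cong S^g\oplus S^g$, $S^g$ the spinor bundle of $(M,g)$, such that $(a,Y,b)\cdot(\varphi,\phi)=(-Y\cdot\varphi-2b\phi,\;Y\cdot\phi+a\varphi)$ and $\nabla^{nc}_X(\varphi,\phi)=(\nabla^{S^g}_X\varphi-X\cdot\phi,\;\nabla^{S^g}_X\phi+\frac12K^g(X)\cdot\varphi)$. $\widetilde\Phi^g(proj^g_+\psi)$ denotes the first component. $\ker P^g$ is the space of twistor spinors: $\nabla^{S^g}_X\varphi+\frac1nX\cdot D^g\varphi=0$ for all $X$, $D^g$ the Dirac operator; $\psi\mapsto\widetilde\Phi^g(proj^g_+\psi)$ is an isomorphism from parallel spin tractors to $\ker P^g$ with inverse $\varphi\mapsto(\varphi,-\frac1nD^g\varphi)$. *)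

(* Defs.v *)
From mathcomp Require Import all_boot all_order all_algebra.
From mathcomp Require Import all_classical all_reals all_analysis.
From mathcomp Require Import complex.

Set Implicit Arguments.
Unset Strict Implicit.
Unset Printing Implicit Defensive.

Import Order.TTheory GRing.Theory Num.Theory.
Import numFieldNormedType.Exports.

Local Open Scope classical_set_scope.
Local Open Scope complex_scope.
Local Open Scope ring_scope.

(* An exterior form on [V] is a function on finite sequences of vectors; a form
of degree [d] vanishes on the sequences whose size is not [d].  With [d] an
integer, the forms of degree [-1] are exactly the zero form. *)

Section Exterior.
Context {R : realType} {V : lmodType R}.
Implicit Types (w : seq V -> R) (s : seq V).

Definition is_form (d : int) w : Prop :=
  [/\ forall s, (size s)%:Z != d -> w s = 0,
      forall s1 s2 (a : R) (u v : V),
        w (s1 ++ (a *: u + v) :: s2) = a * w (s1 ++ u :: s2) + w (s1 ++ v :: s2)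
    & forall s1 s2 s3 (u : V), w (s1 ++ u :: s2 ++ u :: s3) = 0].

Definition omit (l : nat) s : seq V := take l s ++ drop l.+1 s.

(* normalised so that (a /\ b)(u, v) = a u * b v - a v * b u *)
Definition wedge1 (theta : V -> R) w : seq V -> R := fun s =>
  \sum_(l < size s) (-1) ^+ l * theta (nth 0 s l) * w (omit l s).

(* If (b_i) is pseudo-orthonormal with b_i of square length [e i] = +-1, then
   the coefficient of w at b_{i_1}^flat /\ ... /\ b_{i_r}^flat is
   e i_1 * ... * e i_r * w [:: b i_1; ...; b i_r]; the index sets
   i_1 < ... < i_r are the subsets of 'I_m, which [enum] lists increasingly. *)
Definition form_act {m : nat} {W : lmodType R[i]} (b : 'I_m -> V)
    (e : 'I_m -> R) (cl : V -> W -> W) w (z : W) : W :=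
  \sum_(A : {set 'I_m})
     ((\prod_(i in A) e i) * w [seq b i | i <- enum A])%:C *:
       foldr (fun i => cl (b i)) z (enum A).

End Exterior.

Definition eps {R : realType} (p i : nat) : R := if (i < p)%N then -1 else 1.

Definition ip {R : realType} (p : nat) {n : nat} (v w : 'rV[R]_n) : R :=
  \sum_(i < n) eps p i * v 0 i * w 0 i.

(* Tractor fibre: (a, Y, b) = a s_- + Y + b s_+. *)
Definition tractor (R : realType) (n : nat) : lmodType R :=
  (R^o * 'rV[R]_n * R^o)%type.

Definition tractor_ip {R : realType} (p : nat) {n : nat}
    (t1 t2 : tractor R n) : R :=
  let: (a1, Y1, b1) := t1 in let: (a2, Y2, b2) := t2 in
  a1 * b2 + a2 * b1 + ip p Y1 Y2.

Definition s_minus {R : realType} {n : nat} : tractor R n := (1, 0, 0).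
Definition s_plus {R : realType} {n : nat} : tractor R n := (0, 0, 1).

(* The pseudo-orthonormal basis (s_+ - s_-)/sqrt 2, e_1, ..., e_n,
   (s_+ + s_-)/sqrt 2; the square length of its i-th vector is eps p.+1 i. *)
Definition tractor_basis {R : realType} {n : nat} (i : 'I_n.+2) :
    tractor R n :=
  match unlift ord0 i with
  | None => (- (Num.sqrt 2)^-1, 0, (Num.sqrt 2)^-1)
  | Some j => match unlift ord_max j with
              | None => ((Num.sqrt 2)^-1, 0, (Num.sqrt 2)^-1)
              | Some a => (0, delta_mx 0 a, 0)
              end
  end.

Record spinor_module (R : realType) (p q : nat) := SpinorModule {
  sdim : nat;
  gamma : 'I_(p + q) -> 'M[R[i]]_sdim;
  gamma_clifford : forall a b : 'I_(p + q),
    gamma a *m gamma b + gamma b *m gamma a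
    = (- 2 * (if a == b then eps p a else 0 : R))%:C%:M;
  sdim_gt0 : (0 < sdim)%N;
  gamma_irreducible : forall U : {vspace 'cV[R[i]]_sdim},
    (forall a z, z \in U -> gamma a *m z \in U) -> U = 0%VS \/ U = fullv
}.

Section Clifford.
Context {R : realType} {p q : nat}.
Variable S : spinor_module R p q.

Definition spinor : lmodType R[i] := 'cV[R[i]]_(sdim S).
Definition spin_tractor : lmodType R[i] := (spinor * spinor)%type.

Definition clmx (v : 'rV[R]_(p + q)) : 'M[R[i]]_(sdim S) :=
  \sum_a (v 0 a)%:C *: gamma S a.

Definition cl (v : 'rV[R]_(p + q)) (z : spinor) : spinor := clmx v *m z.

Definition tractor_cl (t : tractor R (p + q)) (z : spin_tractor) :
    spin_tractor :=
  let: (a, Y, b) := t in let: (z1, z2) := z in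
  (- cl Y z1 - (2 * b)%:C *: z2, cl Y z2 + a%:C *: z1).

Definition tangent_form_act (w : seq 'rV[R]_(p + q) -> R) (z : spinor) :
    spinor :=
  form_act (fun a : 'I_(p + q) => delta_mx 0 a) (fun a => eps p a) cl w z.

Definition tractor_form_act (w : seq (tractor R (p + q)) -> R)
    (z : spin_tractor) : spin_tractor :=
  form_act (@tractor_basis R (p + q)) (fun a => eps p.+1 a) tractor_cl w z.

(* The image of Spin^+(p,q) in GL(spinor): products of an even number of unit
   spacelike and an even number of unit timelike vectors.  The spinor
   representation is faithful on the spin group. *)
Definition in_spin_plus (A : 'M[R[i]]_(sdim S)) : Prop :=
  exists s : seq 'rV[R]_(p + q),
    [/\ all (fun v => (ip p v v == 1) || (ip p v v == -1)) s,
        ~~ odd (count (fun v => ip p v v == 1) s),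
        ~~ odd (count (fun v => ip p v v == -1) s)
      & A = foldr (fun v B => clmx v *m B) 1%:M s].

End Clifford.

Fixpoint Ck {R : realType} {n : nat} (k : nat) (O : set 'rV[R]_n)
    (f : 'rV[R]_n -> R) : Prop :=
  (forall u, O u -> {for u, continuous f}) /\
  match k with
  | 0 => True
  | k'.+1 => forall v, (forall u, O u -> derivable f u v) /\
                       Ck k' O (fun u => 'D_v f u)
  end.

Definition smooth {R : realType} {n : nat} (O : set 'rV[R]_n)
    (f : 'rV[R]_n -> R) : Prop := forall k, Ck k O f.

(* The conformal class is given by a representative g0, and g0 by its
orthonormal frames: over each chart domain [dom i] there is a frame whose b-th
vector field has coordinate components [row b (frame0 i x)].  Two such frames
are related by [lam i j] (e^j_b = sum_a (lam i j)_{b a} e^i_a), the image of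
the cocycle [spin i j] under the covering Spin^+(p,q) -> SO^+(p,q).  So the
frames define g0 together with its space- and time-orientation, and the
cocycle defines the spin structure.  Charts and frames share their index set:
any bundle atlas can be refined to this form. *)

Record conformal_spin_manifold (R : realType) (p q : nat)
    (S : spinor_module R p q) (M : topologicalType) := ConformalSpinManifold {
  idx : Type;
  dom : idx -> set M;
  coord : idx -> M -> 'rV[R]_(p + q);
  param : idx -> 'rV[R]_(p + q) -> M;
  frame0 : idx -> M -> 'M[R]_(p + q);
  lam : idx -> idx -> M -> 'M[R]_(p + q);
  spin : idx -> idx -> M -> 'M[R[i]]_(sdim S);
  manifold_hausdorff : hausdorff_space M;
  manifold_countable : @second_countable M;
  dom_open : forall i, open (dom i);
  dom_cover : forall x, exists i, dom i x;
  coord_open : forall i, open (coord i @` dom i);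
  coordK : forall i x, dom i x -> param i (coord i x) = x;
  coord_continuous : forall i x, dom i x -> {for x, continuous (coord i)};
  param_continuous : forall i u,
    (coord i @` dom i) u -> {for u, continuous (param i)};
  coord_smooth : forall i j (m : 'I_(p + q)),
    smooth [set u | (coord i @` dom i) u /\ dom j (param i u)]
           (fun u => coord j (param i u) 0 m);
  frame0_smooth : forall i a b,
    smooth (coord i @` dom i) (fun u => frame0 i (param i u) a b);
  frame0_unit : forall i x, dom i x -> frame0 i x \in unitmx;
  frame0_change : forall i j x, dom i x -> dom j x -> forall b m,
    frame0 j x b m =
      \sum_a lam i j x b a *
        'D_(row a (frame0 i x)) (fun u => coord j (param i u) 0 m) (coord i x);
  spin_plus : forall i j x, dom i x -> dom j x -> in_spin_plus (spin i j x);
  spin_smooth : forall i j a b,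
    smooth [set u | (coord i @` dom i) u /\ dom j (param i u)]
           (fun u => complex.Re (spin i j (param i u) a b)) /\
    smooth [set u | (coord i @` dom i) u /\ dom j (param i u)]
           (fun u => complex.Im (spin i j (param i u) a b));
  spin_cover : forall i j x, dom i x -> dom j x -> forall v,
    spin i j x *m clmx S v = clmx S (v *m lam i j x) *m spin i j x;
  spin_cocycle : forall i j l x, dom i x -> dom j x -> dom l x ->
    spin i l x = spin i j x *m spin j l x
}.

Section Geometry.
Context {R : realType} {p q : nat} {S : spinor_module R p q}.
Context {M : topologicalType}.
Variable c : conformal_spin_manifold S M.

Local Notation n := (p + q)%N.
Local Notation vec := 'rV[R]_(p + q).
Local Notation trac := (tractor R (p + q)).

Definition e_ (a : 'I_n) : vec := delta_mx 0 a.

Definition smooth_chart (i : idx c) (f : M -> R) : Prop :=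
  smooth (coord i @` dom i) (f \o param i).

(* The metrics in the conformal class are the exp (2 sg) g0; below, the metric
   is always designated by sg. *)
Definition conf_factor (sg : M -> R) : Prop := forall i, smooth_chart i sg.

Section Metric.
Variables (sg : M -> R) (i : idx c).

(* Everything in this section is over [dom i], with tangent vectors given by
their components in the frame that is orthonormal for exp (2 sg) g0. *)

Definition frame (x : M) : 'M[R]_n := expR (- sg x) *: frame0 i x.

Definition dvec (v : vec) (f : M -> R) (x : M) : R :=
  'D_(v *m frame x) (f \o param i) (coord i x).

(* [v, w] for the vector fields whose frame components are constant *)
Definition bracket (v w : vec) (x : M) : vec :=
  \row_m (dvec v (fun y => (w *m frame y) 0 m) x
          - dvec w (fun y => (v *m frame y) 0 m) x) *m invmx (frame x).

(* Koszul formula for the Levi-Civita connection: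
   nabla_{e_a} e_b = sum_d (christoffel a b d) e_d *)
Definition christoffel (a b d : 'I_n) (x : M) : R :=
  2^-1 * eps p d * (eps p d * bracket (e_ a) (e_ b) x 0 d
                    - eps p a * bracket (e_ b) (e_ d) x 0 a
                    + eps p b * bracket (e_ d) (e_ a) x 0 b).

Definition conn (v : vec) (x : M) : 'M[R]_n :=
  \matrix_(b, d) \sum_a v 0 a * christoffel a b d x.

Definition nabla (v : vec) (Y : M -> vec) (x : M) : vec :=
  \row_m dvec v (fun y => Y y 0 m) x + Y x *m conn v x.

(* R(v, w) e_b = sum_d (curv v w)_{b d} e_d, where
   R(X, Y) = [nabla_X, nabla_Y] - nabla_{[X, Y]} *)
Definition curv (v w : vec) (x : M) : 'M[R]_n :=
  \matrix_(b, d) (dvec v (fun y => conn w y b d) x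
                  - dvec w (fun y => conn v y b d) x)
  + conn w x *m conn v x - conn v x *m conn w x - conn (bracket v w x) x.

Definition ricci (x : M) : 'M[R]_n :=
  \matrix_(b, d) \sum_a curv (e_ a) (e_ b) x d a.

Definition scal (x : M) : R := \sum_(a < n) eps p a * ricci x a a.

Definition K (x : M) : 'M[R]_n :=
  (n%:R - 2)^-1 *:
    (scal x / (2 * (n%:R - 1)) *: diag_mx (\row_(a < n) eps p a) - ricci x).

Definition Kform (v w : vec) (x : M) : R := (v *m K x *m w^T) 0 0.

Definition Ksharp (v : vec) (x : M) : vec :=
  \row_(b < n) (eps p b * Kform v (e_ b) x).

Definition nabla_tractor (v : vec) (T : M -> trac) (x : M) : trac :=
  let: (a, Y, b) := T x in
  (dvec v (fun y => (T y).1.1) x + Kform v Y x,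
   nabla v (fun y => (T y).1.2) x + a *: v - b *: Ksharp v x,
   dvec v (fun y => (T y).2) x - ip p v Y).

(* The connection induced on forms, evaluated on sections with constant
   components; [nab] is nabla_v on sections. *)
Definition nabla_form {V : lmodType R} (nab : (M -> V) -> M -> V) (v : vec)
    (w : M -> seq V -> R) (x : M) (s : seq V) : R :=
  dvec v (fun y => w y s) x
  - \sum_(l < size s)
       w x (set_nth 0 s l (nab (fun=> nth 0 s l) x)).

Definition ext_derivative (w : M -> seq vec -> R) (x : M) (s : seq vec) : R :=
  \sum_(l < size s)
     (-1) ^+ l * dvec (nth 0 s l) (fun y => w y (omit l s)) x
  + \sum_(l < size s) \sum_(m < size s | (l < m)%N)
     (-1) ^+ (l + m) *
       w x (bracket (nth 0 s l) (nth 0 s m) x :: omit l (omit m s)).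

Definition codifferential (w : M -> seq vec -> R) (x : M) (s : seq vec) : R :=
  - \sum_(a < n) eps p a * nabla_form (nabla (e_ a)) (e_ a) w x (e_ a :: s).

Definition dspinor (v : vec) (phi : M -> spinor S) (x : M) : spinor S :=
  \col_m Complex (dvec v (fun y => complex.Re (phi y m 0)) x)
                 (dvec v (fun y => complex.Im (phi y m 0)) x).

(* 1/2 sum_{a<b} eps_a eps_b g(nabla_v e_a, e_b) e_a . e_b *)
Definition spin_conn (v : vec) (x : M) : 'M[R[i]]_(sdim S) :=
  \sum_(a < n) \sum_(b < n | (a < b)%N)
    (2^-1 * eps p a * eps p b * ip p (nabla v (fun=> e_ a) x) (e_ b))%:C *:
      (gamma S a *m gamma S b).

Definition nabla_spinor (v : vec) (phi : M -> spinor S) (x : M) : spinor S :=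
  dspinor v phi x + spin_conn v x *m phi x.

Definition dirac_op (phi : M -> spinor S) (x : M) : spinor S :=
  \sum_(a < n) (eps p a)%:C *: cl (e_ a) (nabla_spinor (e_ a) phi x).

Definition nabla_spin_tractor (v : vec) (psi : M -> spin_tractor S) (x : M) :
    spin_tractor S :=
  (nabla_spinor v (fun y => (psi y).1) x - cl v (psi x).2,
   nabla_spinor v (fun y => (psi y).2) x
     + 2^-1 *: cl (Ksharp v x) (psi x).1).

End Metric.

(* A field is the family of its component functions over the [dom i]; since the
orthonormal frames of the metrics in the class are proportional to each other,
with the same transition functions, being a field does not involve [sg]. *)

Definition tangent_form (d : int) (w : idx c -> M -> seq vec -> R) : Prop :=
  [/\ forall i x, dom i x -> is_form d (w i x),
      forall i s, smooth_chart i (fun x => w i x s)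
    & forall i j x s, dom i x -> dom j x ->
        w j x s = w i x [seq v *m lam i j x | v <- s]].

Definition smooth_spinor (i : idx c) (phi : M -> spinor S) : Prop :=
  forall m, smooth_chart i (fun x => complex.Re (phi x m 0)) /\
            smooth_chart i (fun x => complex.Im (phi x m 0)).

Definition spinor_field (phi : idx c -> M -> spinor S) : Prop :=
  (forall i, smooth_spinor i (phi i)) /\
  (forall i j x, dom i x -> dom j x -> phi i x = spin i j x *m phi j x).

Definition twistor_spinor (sg : M -> R) (phi : idx c -> M -> spinor S) :
    Prop :=
  spinor_field phi /\
  forall i x v, dom i x ->
    nabla_spinor sg i v (phi i) x
      + n%:R^-1 *: cl v (dirac_op sg i (phi i) x) = 0.

(* A metric in the class identifies tractors with triples and spin tractors with
pairs of spinors.  Sections of the tractor bundles of the conformal class are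
families of such, indexed by the metrics in the class and compatible with the
changes of identification [retractor] and [respin] from [sg] to [sg'].  The
connections are conformally invariant, so that asking for parallelism with
respect to every metric or to a single one is the same. *)

Section Rescaling.
Variables (sg sg' : M -> R) (i : idx c) (x : M).

(* gradient of sg' - sg for the metric sg *)
Definition ups : vec :=
  \row_(a < n) (eps p a * dvec sg i (e_ a) (fun y => sg' y - sg y) x).

(* In the frame that is orthonormal for sg', the vector exp (- (sg' - sg)) Y
   has the same components as Y in the frame for sg. *)
Definition retractor (t : trac) : trac :=
  let: (a, Y, b) := t in
  (expR (- (sg' x - sg x)) * (a - ip p Y ups - b / 2 * ip p ups ups),
   Y + b *: ups,
   expR (sg' x - sg x) * b).

Definition respin (z : spin_tractor S) : spin_tractor S :=
  let: (z1, z2) := z in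
  ((expR ((sg' x - sg x) / 2))%:C *: z1,
   (expR (- (sg' x - sg x) / 2))%:C *: (z2 - 2^-1 *: cl ups z1)).

End Rescaling.

Definition tractor_form (d : int)
    (alpha : (M -> R) -> idx c -> M -> seq trac -> R) : Prop :=
  [/\ forall sg, conf_factor sg -> forall i x, dom i x ->
        is_form d (alpha sg i x),
      forall sg, conf_factor sg -> forall i s,
        smooth_chart i (fun x => alpha sg i x s),
      forall sg, conf_factor sg -> forall i j x s, dom i x -> dom j x ->
        alpha sg j x s =
          alpha sg i x [seq (t.1.1, t.1.2 *m lam i j x, t.2) : trac | t <- s]
    & forall sg sg', conf_factor sg -> conf_factor sg' ->
        forall i x s, dom i x ->
        alpha sg' i x [seq retractor sg sg' i x t | t <- s] = alpha sg i x s].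

Definition spin_tractor_field
    (psi : (M -> R) -> idx c -> M -> spin_tractor S) : Prop :=
  [/\ forall sg, conf_factor sg -> spinor_field (fun i x => (psi sg i x).1),
      forall sg, conf_factor sg -> spinor_field (fun i x => (psi sg i x).2)
    & forall sg sg', conf_factor sg -> conf_factor sg' ->
        forall i x, dom i x ->
        psi sg' i x = respin sg sg' i x (psi sg i x)].

Definition parallel_form
    (alpha : (M -> R) -> idx c -> M -> seq trac -> R) : Prop :=
  forall sg, conf_factor sg -> forall i x v s, dom i x ->
    nabla_form sg i (nabla_tractor sg i v) v (alpha sg i) x s = 0.

Definition parallel_spin_tractor
    (psi : (M -> R) -> idx c -> M -> spin_tractor S) : Prop :=
  forall sg, conf_factor sg -> forall i x v, dom i x ->
    nabla_spin_tractor sg i v (psi sg i) x = 0.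

Definition tractor_clifford
    (alpha : (M -> R) -> idx c -> M -> seq trac -> R)
    (psi : (M -> R) -> idx c -> M -> spin_tractor S) :
    (M -> R) -> idx c -> M -> spin_tractor S :=
  fun sg i x => tractor_form_act (alpha sg i x) (psi sg i x).

(* alpha = s_+ /\ alpha_+ + alpha_0 + s_- /\ s_+ /\ alpha_-+ + s_- /\ alpha_-,
   tangent forms being extended by 0 on s_+ and s_-. *)
Definition tractor_components (alpha : seq trac -> R)
    (ap a0 amp am : seq vec -> R) : Prop :=
  let ext (w : seq vec -> R) (s : seq trac) := w [seq t.1.2 | t <- s] in
  forall s, alpha s =
    wedge1 (tractor_ip p s_plus) (ext ap) s
    + ext a0 s
    + wedge1 (tractor_ip p s_minus)
        (wedge1 (tractor_ip p s_plus) (ext amp)) s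
    + wedge1 (tractor_ip p s_minus) (ext am) s.

End Geometry.

(* Main.v *)
From mathcomp Require Import all_boot all_order all_algebra.
From mathcomp Require Import all_classical all_reals all_analysis.
From mathcomp Require Import complex.
From mathcomp Require Import ring lra zify.
Require Import Defs.

(** Let [c] be Clifford multiplication on a module over the Clifford algebra of
    a metric.  The action of a form of degree d is d!^-1 times the iteration of
    the metric contraction

      z |-> sum_i e_i c(b_i) (b_i hook w)(z)

    over a pseudo-orthonormal frame (b_i) with signs e_i: the sum over all words
    of frame vectors may replace the sum over the increasing ones, since w and
    the product of anticommuting vectors change sign together
    ([form_act_contr]).  In this form the action does not depend on the frame,
    because a metric contraction does not.  Hence isometries that are covered by
    a map of spinors carry the action over ([contr_intertwine]), and skew maps
    that are covered by an operator on spinors satisfy the Leibniz rule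
    ([contr_derivation]).

    The isometries that occur are the transition functions of the tractor bundle
    and the changes of metric in the conformal class; so alpha . psi is a spin
    tractor field ([tractor_clifford_field]).  The skew maps are the zeroth-order
    parts of the tractor connection, covered by those of the spin tractor
    connection ([conn_map_derivation]); so the covariant derivative of
    alpha . psi is (nabla alpha) . psi + alpha . nabla psi, which is zero
    ([parallel_tractor_form_act]).

    The first component phi of a parallel spin tractor (phi, chi) satisfies
    nabla_X phi = X . chi.  Contraction gives D phi = - n chi, so that phi is a
    twistor spinor and chi = - D phi / n ([parallel_twistor]).  This applies to
    psi and to alpha . psi.

    For the formula, s_+ acts on pairs by (z1, z2) |-> (- 2 z2, 0), s_- by
    (z1, z2) |-> (0, z1), and s_-^flat /\ s_+^flat as s_- . s_+ + 1 because
    <s_-, s_+> = 1.  A tangent form of degree r acts on z1 with the sign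
    (-1)^r.  The two components of the action of alpha follow
    ([components_act]); the proof is by induction on the degree, through the
    identity d w = sum_i e_i c(b_i) (b_i hook w) for the actions
    ([form_act_rec]).

    Finally, nabla alpha = 0 evaluated on s_-, Y_1, ..., Y_k reads
    nabla_X alpha_+ = X hook alpha_0 + X^flat /\ alpha_-+ ([nabla_component]).
    Its contraction expresses d^* alpha_+ by alpha_-+
    ([codifferential_component]) and its alternation, the connection being
    torsion-free, expresses d alpha_+ by alpha_0
    ([ext_derivative_component]). *)

Set Implicit Arguments.
Unset Strict Implicit.
Unset Printing Implicit Defensive.

Import Order.TTheory GRing.Theory Num.Theory.
Import numFieldNormedType.Exports.

Local Open Scope classical_set_scope.
Local Open Scope complex_scope.
Local Open Scope ring_scope.

(** * Linear identities in modules *)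

Section LinearExpressions.
Context {K : comNzRingType} {W : lmodType K}.

Inductive lexpr :=
  | LZero | LAtom of nat | LAdd of lexpr & lexpr | LOpp of lexpr
  | LScale of K & lexpr.

Fixpoint leval (xs : seq W) (t : lexpr) : W :=
  match t with
  | LZero => 0
  | LAtom i => nth 0 xs i
  | LAdd t1 t2 => leval xs t1 + leval xs t2
  | LOpp t1 => - leval xs t1
  | LScale a t1 => a *: leval xs t1
  end.

Fixpoint lcoef (t : lexpr) (i : nat) : K :=
  match t with
  | LZero => 0
  | LAtom j => if Nat.eqb i j then 1 else 0
  | LAdd t1 t2 => lcoef t1 i + lcoef t2 i
  | LOpp t1 => - lcoef t1 i
  | LScale a t1 => a * lcoef t1 i
  end.

Fixpoint same_coefs (t1 t2 : lexpr) (n : nat) : Prop :=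
  if n is n'.+1 then lcoef t1 n' = lcoef t2 n' /\ same_coefs t1 t2 n' else True.

Lemma leval_sum xs t :
  leval xs t = \sum_(i < size xs) lcoef t i *: nth 0 xs i.
Proof.
have eqE i j : Nat.eqb i j = (i == j) by [].
elim: t => [|j|t1 IH1 t2 IH2|t IH|a t IH] /=.
- by rewrite big1 // => i _; rewrite scale0r.
- have [js|js] := ltnP j (size xs).
    rewrite (bigD1 (Ordinal js)) //= eqE eqxx scale1r big1 ?addr0 // => i ij.
    by rewrite eqE (_ : (i == j :> nat) = false) ?scale0r //; apply: negbTE.
  rewrite nth_default // big1 // => i _.
  by rewrite eqE ltn_eqF ?scale0r // (leq_trans (ltn_ord i)).
- by rewrite IH1 IH2 -big_split; apply: eq_bigr => i _; rewrite scalerDl.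
- by rewrite IH -sumrN; apply: eq_bigr => i _; rewrite scaleNr.
- by rewrite IH scaler_sumr; apply: eq_bigr => i _; rewrite scalerA.
Qed.

Lemma leval_eq xs t1 t2 :
  same_coefs t1 t2 (size xs) -> leval xs t1 = leval xs t2.
Proof.
rewrite !leval_sum; elim: (size xs) => [|n IH] /=; first by rewrite !big_ord0.
by case=> E /IH {}IH; rewrite !big_ord_recr /= IH E.
Qed.

End LinearExpressions.

(** Atoms are compared up to conversion: equal terms may be built with different
    but convertible instances of the module structure. *)
Ltac atom_index x xs :=
  match xs with
  | ?y :: _ => let _ := match goal with _ => unify x y end in constr:(0%N)
  | _ :: ?xs' => let i := atom_index x xs' in constr:(S i)
  end.

Ltac collect_atoms t xs :=
  lazymatch t with
  | (?t1 + ?t2)%R => let xs1 := collect_atoms t1 xs in collect_atoms t2 xs1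
  | (- ?t1)%R => collect_atoms t1 xs
  | (_ *: ?t1)%R => collect_atoms t1 xs
  | 0%R => xs
  | _ => match xs with
         | _ => let i := atom_index t xs in xs
         | _ => constr:(t :: xs)
         end
  end.

Ltac reify_linear K t xs :=
  lazymatch t with
  | (?t1 + ?t2)%R => let r1 := reify_linear K t1 xs in
                     let r2 := reify_linear K t2 xs in constr:(@LAdd K r1 r2)
  | (- ?t1)%R => let r1 := reify_linear K t1 xs in constr:(@LOpp K r1)
  | (?a *: ?t1)%R => let r1 := reify_linear K t1 xs in constr:(@LScale K a r1)
  | 0%R => constr:(@LZero K)
  | _ => let i := atom_index t xs in constr:(@LAtom K i)
  end.

(** Decides an identity of linear expressions in a module over a commutative
    ring: it suffices that every atom has the same coefficient on both sides. *)
Ltac linear_identity_by K W tac :=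
  lazymatch goal with |- ?t1 = ?t2 =>
    let xs0 := collect_atoms t1 (@nil (GRing.Lmodule.sort W)) in
    let xs := collect_atoms t2 xs0 in
    let r1 := reify_linear K t1 xs in
    let r2 := reify_linear K t2 xs in
    refine (@leval_eq K W xs r1 r2 _);
    cbv [same_coefs lcoef size Nat.eqb]; repeat split; tac
  end.

Ltac linear_identity K W := linear_identity_by K W ltac:(ring).

Section LinearMaps.
Context {K : comNzRingType} {W W' : lmodType K}.
Variable f : W -> W'.
Hypothesis lf : linear f.

Lemma linD x y : f (x + y) = f x + f y.
Proof. by rewrite -[x]scale1r lf !scale1r. Qed.

Lemma lin0 : f 0 = 0.
Proof. by have := lf (-1) 0 0; rewrite scaler0 addr0 scaleN1r => ->; exact: addNr. Qed.

Lemma linZ a x : f (a *: x) = a *: f x.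
Proof. by rewrite -[a *: x]addr0 lf lin0 addr0. Qed.

Lemma linN x : f (- x) = - f x.
Proof. by rewrite -scaleN1r linZ scaleN1r. Qed.

Lemma lin_sum (I : finType) (P : pred I) (F : I -> W) :
  f (\sum_(i | P i) F i) = \sum_(i | P i) f (F i).
Proof. by apply: (big_morph f) => [x y|]; [exact: linD | exact: lin0]. Qed.

End LinearMaps.

Section PairModule.
Context {K : comNzRingType} {W W' : lmodType K}.

Lemma pairD (x y : W) (x' y' : W') :
  ((x, x') : (W * W')%type) + (y, y') = (x + y, x' + y').
Proof. by []. Qed.

Lemma pairZ a (x : W) (x' : W') :
  a *: ((x, x') : (W * W')%type) = (a *: x, a *: x').
Proof. by []. Qed.

End PairModule.

Lemma halfK (R : realType) (W : lmodType R[i]) (y : W) :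
  (2^-1 : R)%:C *: (y + y) = y.
Proof.
rewrite -mulr2n -[y *+ 2]scaler_nat scalerA -(rmorph_nat (real_complex R) 2).
by rewrite -rmorphM mulVf ?pnatr_eq0 // rmorph1 scale1r.
Qed.

Lemma linear_opp_scale (K : comNzRingType) (W W' : lmodType K) (f : W -> W') a b z :
  linear f -> - a *: f (- (b *: z)) = (a * b) *: f z.
Proof. by move=> lf; rewrite (linN lf) (linZ lf) scalerN scaleNr opprK scalerA. Qed.

(** * Alternating forms *)

Section FormTheory.
Context {R : realType} {V : lmodType R}.
Implicit Types (w : seq V -> R) (s : seq V).

Definition mlin w : Prop := forall s1 s2 (a : R) (u v : V),
  w (s1 ++ (a *: u + v) :: s2) = a * w (s1 ++ u :: s2) + w (s1 ++ v :: s2).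

Lemma mlinD w s1 s2 (u v : V) : mlin w ->
  w (s1 ++ (u + v) :: s2) = w (s1 ++ u :: s2) + w (s1 ++ v :: s2).
Proof. by move=> lw; rewrite -[u]scale1r lw scale1r mul1r. Qed.

Lemma mlin0 w s1 s2 : mlin w -> w (s1 ++ 0 :: s2) = 0.
Proof.
move=> lw; have := lw s1 s2 1 0 0; rewrite scaler0 addr0 mul1r.
by move/(congr1 (fun r => r - w (s1 ++ 0 :: s2))); rewrite addrK subrr.
Qed.

Lemma mlinZ w s1 s2 a (u : V) : mlin w ->
  w (s1 ++ (a *: u) :: s2) = a * w (s1 ++ u :: s2).
Proof. by move=> lw; rewrite -[_ *: _]addr0 lw mlin0 // addr0. Qed.

(** The interior product. *)
Definition hook (u : V) w : seq V -> R := fun s => w (u :: s).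

Lemma mlin_hook w u : mlin w -> mlin (hook u w).
Proof. by move=> lw s1 s2 a v1 v2; rewrite /hook -!cat_cons lw. Qed.

Lemma form_mlin d w : is_form d w -> mlin w.
Proof. by case. Qed.

Lemma form_hook d w u : is_form d w -> is_form (d - 1) (hook u w).
Proof.
case=> w1 w2 w3; split.
- by move=> s sd; apply: w1; apply: contra_neq sd => /=; lia.
- exact: mlin_hook.
- by move=> s1 s2 s3 v; rewrite /hook -cat_cons w3.
Qed.

Lemma form_swap d w s1 s2 (u v : V) : is_form d w ->
  w (s1 ++ u :: v :: s2) = - w (s1 ++ v :: u :: s2).
Proof.
case=> _ w2 w3.
have := w3 s1 [::] s2 (u + v); rewrite /= (mlinD _ _ _ _ w2).
have -> : s1 ++ u :: u + v :: s2 = (s1 ++ [:: u]) ++ (u + v) :: s2.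
  by rewrite -catA.
have -> : s1 ++ v :: u + v :: s2 = (s1 ++ [:: v]) ++ (u + v) :: s2.
  by rewrite -catA.
rewrite !(mlinD _ _ _ _ w2) -!catA /=.
rewrite (w3 s1 [::] s2 u) (w3 s1 [::] s2 v) addr0 add0r.
by move/eqP; rewrite addr_eq0 => /eqP.
Qed.

Lemma form_move d w s1 s2 (u : V) : is_form d w ->
  w (s1 ++ u :: s2) = (-1) ^+ size s1 * w (u :: s1 ++ s2).
Proof.
move=> fw; elim/last_ind: s1 s2 => [|s1 v IH] s2; first by rewrite mul1r.
rewrite cat_rcons (form_swap _ _ _ _ fw) IH size_rcons exprS mulN1r mulNr.
by rewrite cat_rcons.
Qed.

Lemma form_dup d w s1 s2 (u : V) : is_form d w -> w (u :: s1 ++ u :: s2) = 0.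
Proof. by case=> _ _ w3; exact: (w3 [::]). Qed.

Lemma form_dup_mem d w s (u : V) : is_form d w -> u \in s -> w (u :: s) = 0.
Proof. by move=> fw /splitPr[s1 s2]; rewrite (form_dup _ _ _ fw). Qed.

Lemma form_size d w s : is_form d w -> (size s)%:Z != d -> w s = 0.
Proof. by case=> w1 _ _; exact: w1. Qed.

(** The graded Leibniz rule of the interior product. *)
Lemma wedge1_cons (theta : V -> R) w u s :
  wedge1 theta w (u :: s) =
    theta u * w s - wedge1 theta (hook u w) s.
Proof.
rewrite /wedge1 /= big_ord_recl expr0 mul1r /omit /= drop0; congr (_ + _).
rewrite -sumrN; apply: eq_bigr => i _.
by rewrite /bump /= add1n exprS mulN1r !mulNr.
Qed.

Lemma wedge1_nil (theta : V -> R) w : wedge1 theta w [::] = 0.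
Proof. by rewrite /wedge1 big_ord0. Qed.

Lemma wedge1_linear (theta : V -> R) a (w w' : seq V -> R) s :
  wedge1 theta (fun s => a * w s + w' s) s =
  a * wedge1 theta w s + wedge1 theta w' s.
Proof.
rewrite /wedge1 mulr_sumr -big_split; apply: eq_bigr => l _.
by rewrite mulrDr mulrCA.
Qed.

Lemma eq_wedge1 (theta : V -> R) (w w' : seq V -> R) :
  w =1 w' -> wedge1 theta w =1 wedge1 theta w'.
Proof. by move=> ww' s; apply: eq_bigr => l _; rewrite ww'. Qed.

Lemma wedge1Z (theta : V -> R) a (w : seq V -> R) s :
  wedge1 theta (fun s => a * w s) s = a * wedge1 theta w s.
Proof.
by rewrite /wedge1 mulr_sumr; apply: eq_bigr => l _; rewrite mulrCA.
Qed.

Lemma mlin_sum (I : finType) w (F : I -> V) s : mlin w ->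
  w ((\sum_i F i) :: s) = \sum_i w (F i :: s).
Proof.
move=> lw; apply: (big_morph (fun u => w (u :: s))) => [u v|].
  exact: (mlinD [::]).
exact: (mlin0 [::]).
Qed.

(** Minus the natural action of the endomorphism [L] on forms. *)
Definition form_deriv (L : V -> V) (w : seq V -> R) (s : seq V) : R :=
  \sum_(l < size s) w (set_nth 0 s l (L (nth 0 s l))).

Lemma form_deriv_cons (L : V -> V) w t s :
  form_deriv L w (t :: s) = w (L t :: s) + form_deriv L (hook t w) s.
Proof. by rewrite /form_deriv /= big_ord_recl. Qed.

End FormTheory.

Section FormClosure.
Context {R : realType} {V : lmodType R}.
Implicit Types (w : seq V -> R) (d : int).

Lemma form_hook_deg d d' w u :
  is_form d w -> d - 1 = d' -> is_form d' (hook u w).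
Proof. by move=> fw <-; exact: form_hook. Qed.

Lemma form_linear_comb d a w w' :
  is_form d w -> is_form d w' -> is_form d (fun s => a * w s + w' s).
Proof.
move=> [w1 w2 w3] [v1 v2 v3]; split.
- by move=> s sr; rewrite w1 // v1 // mulr0 addr0.
- by move=> s1 s2 x u v; rewrite w2 v2; ring.
- by move=> s1 s2 s3 u; rewrite w3 v3 mulr0 addr0.
Qed.

Lemma form_opp d w : is_form d w -> is_form d (fun s => - w s).
Proof.
move=> [w1 w2 w3]; split.
- by move=> s sr; rewrite w1 // oppr0.
- by move=> s1 s2 x u v; rewrite w2; ring.
- by move=> s1 s2 s3 u; rewrite w3 oppr0.
Qed.

End FormClosure.

Section Omit.
Context {R : realType} {V : lmodType R}.
Implicit Types (s : seq V) (w : seq V -> R).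

Lemma omit_cons l u s : omit l.+1 (u :: s) = u :: omit l s.
Proof. by []. Qed.

Lemma omit0_cons u s : omit 0 (u :: s) = s.
Proof. by rewrite /omit take0 /= drop0. Qed.

Lemma omit_omit l m s : (l <= m)%N -> omit m (omit l s) = omit l (omit m.+1 s).
Proof.
elim: s l m => [//|u s IH] [|l] [|m] // lm.
- by rewrite !omit_cons !omit0_cons.
- by rewrite !omit_cons !omit0_cons.
- by rewrite !omit_cons IH.
Qed.

Lemma nth_omit l m s : nth 0 (omit l s) m = nth 0 s (bump l m).
Proof.
elim: s l m => [|u s IH] l m; first by rewrite /omit /= !nth_nil.
case: l => [|l]; first by rewrite omit0_cons.
by rewrite omit_cons; case: m => [|m] //=; rewrite IH /bump ltnS addnS.
Qed.

Lemma size_omit l s : (l < size s)%N -> size (omit l s) = (size s).-1.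
Proof.
elim: s l => [//|u s IH] [|l] ls; first by rewrite omit0_cons.
by rewrite omit_cons [LHS]/= IH //; case: (s) ls.
Qed.

Lemma form_omit d w l s : is_form d w -> (l < size s)%N ->
  w (nth 0 s l :: omit l s) = (-1) ^+ l * w s.
Proof.
move=> fw ls; rewrite -{3}(cat_take_drop l s) (drop_nth 0 ls).
rewrite (form_move _ _ _ fw) size_take ls mulrA -expr2 -exprM mulnC exprM sqrrN.
by rewrite expr1n expr1n mul1r.
Qed.

Lemma form_set_nth d w l s u : is_form d w -> (l < size s)%N ->
  w (set_nth 0 s l u) = (-1) ^+ l * w (u :: omit l s).
Proof.
by move=> fw ls; rewrite set_nthE ls (form_move _ _ _ fw) size_take ls.
Qed.

Lemma sum_size_omit (f : nat -> R) l s : (l < size s)%N ->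
  \sum_(m < size (omit l s)) f m = \sum_(m < (size s).-1) f m.
Proof.
by move=> ls; rewrite -!(big_mkord xpredT f) size_omit.
Qed.

(** The entry of index [m] after the removal of entry [l] is the original one of
    index [bump l m].  The two indices differ by one exactly when [l] comes
    first, so the two orders in which a pair is removed have opposite signs. *)
Lemma alternating_pairs (N : nat) (G : nat -> nat -> R) :
  \sum_(l < N) \sum_(m < N.-1) (-1) ^+ (l + m) * G l (bump l m) =
  \sum_(l < N) \sum_(m < N | (l < m)%N) (-1) ^+ (l + m) * (G m l - G l m).
Proof.
case: N => [|N]; first by rewrite !big_ord0.
pose H (l m : nat) : R := (-1) ^+ (l + m) * G l m.
have row (l : 'I_N.+1) :
    \sum_(m < N) (-1) ^+ (l + m) * G l (bump l m) =
    \sum_(m < N.+1 | (m < l)%N) H l m - \sum_(m < N.+1 | (l < m)%N) H l m.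
  pose K (m : 'I_N.+1) := (-1) ^+ (l + unbump l m) * G l m.
  transitivity (\sum_(m < N.+1 | m != l) K m).
    have D1 : \sum_m K m = K l + \sum_(m < N.+1 | m != l) K m by rewrite (bigD1 l).
    have D2 : \sum_m K m = K l + \sum_(m < N) K (lift l m) by rewrite (bigD1_ord l).
    move: D1; rewrite D2 => /addrI <-.
    by apply: eq_bigr => m _; rewrite /K bumpK.
  rewrite (bigID (fun m : 'I_N.+1 => (m < l)%N)) /=; congr (_ + _).
    apply: eq_big => [m|m /andP[_ ml]]; first by rewrite -val_eqE /=; case: ltngtP.
    by rewrite /K /H /unbump ltnNge (ltnW ml) subn0.
  rewrite -sumrN; apply: eq_big => [m|m /andP[ml lm]].
    by rewrite -val_eqE /=; case: ltngtP.
  have {ml lm} lm : (l < m)%N by rewrite ltnNge leq_eqVlt negb_or lm andbT; exact: ml.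
  rewrite /K /H /unbump lm -mulNr; congr (_ * _).
  by case: (m : nat) lm => // m' _; rewrite subn1 /= addnS exprS mulN1r opprK.
under eq_bigr do rewrite row.
rewrite big_split /= sumrN (exchange_big_dep xpredT) //= -sumrB; apply: eq_bigr => l _.
rewrite -sumrB; apply: eq_bigr => m _.
by rewrite /H mulrBr [(m + l)%N]addnC.
Qed.

End Omit.

Section PairOmission.
Context {R : realType} {V : lmodType R}.
Implicit Types (s : seq V) (w : seq V -> R).

Let omit2 s l m := omit (minn l m) (omit (maxn l m) s).

Let omit2E s l m : omit m (omit l s) = omit2 s l (bump l m).
Proof.
rewrite /omit2 /bump; case: (leqP l m) => lm.
  have [-> ->] : minn l (1 + m) = l /\ maxn l (1 + m) = m.+1 by lia.
  by rewrite omit_omit.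
by have [-> ->] : minn l (0 + m) = m /\ maxn l (0 + m) = l by lia.
Qed.

Let omit2_lt s l m : (l < m)%N -> omit2 s l m = omit l (omit m s).
Proof. by rewrite /omit2 => lm; have [-> ->] : minn l m = l /\ maxn l m = m by lia. Qed.

Let omit2C s l m : omit2 s l m = omit2 s m l.
Proof. by rewrite /omit2 minnC maxnC. Qed.

(** The alternation of X |-> X^flat /\ w vanishes, because the metric is
    symmetric. *)
Lemma wedge1_alternation (theta : V -> V -> R) w s :
    (forall u v, theta u v = theta v u) ->
  \sum_(l < size s) (-1) ^+ l * wedge1 (theta (nth 0 s l)) w (omit l s) = 0.
Proof.
move=> thetaC.
pose G l m := theta (nth 0 s l) (nth 0 s m) * w (omit2 s l m).
transitivity (\sum_(l < size s) \sum_(m < (size s).-1) (-1) ^+ (l + m) * G l (bump l m)).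
  apply: eq_bigr => l _; rewrite /wedge1.
  rewrite (sum_size_omit (fun m => (-1) ^+ m * theta (nth 0 s l) (nth 0 (omit l s) m) *
    w (omit m (omit l s)))) // mulr_sumr; apply: eq_bigr => m _.
  by rewrite nth_omit omit2E exprD -!mulrA.
rewrite alternating_pairs big1 // => l _; rewrite big1 // => m _.
by rewrite /G thetaC omit2C subrr mulr0.
Qed.

(** When [D u v] is the covariant derivative of the field [v] along [u], the left
    side is the alternation of the zeroth-order terms of nabla w.  It only sees
    the antisymmetric part of [D], which is the bracket for a torsion-free
    connection. *)
Lemma form_alternation d w s (D : V -> V -> V) : is_form d w ->
  \sum_(l < size s) (-1) ^+ l * (\sum_(m < size (omit l s))
     w (set_nth 0 (omit l s) m (D (nth 0 s l) (nth 0 (omit l s) m)))) =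
  - \sum_(l < size s) \sum_(m < size s | (l < m)%N) (-1) ^+ (l + m) *
      w ((D (nth 0 s l) (nth 0 s m) - D (nth 0 s m) (nth 0 s l)) :: omit l (omit m s)).
Proof.
move=> fw.
pose G l m := w (D (nth 0 s l) (nth 0 s m) :: omit2 s l m).
transitivity (\sum_(l < size s) \sum_(m < (size s).-1) (-1) ^+ (l + m) * G l (bump l m)).
  apply: eq_bigr => l _.
  rewrite (sum_size_omit (fun m =>
    w (set_nth 0 (omit l s) m (D (nth 0 s l) (nth 0 (omit l s) m))))) //.
  rewrite mulr_sumr; apply: eq_bigr => m _.
  rewrite (form_set_nth _ fw) ?size_omit // nth_omit omit2E exprD mulrA.
  by [].
rewrite alternating_pairs -sumrN; apply: eq_bigr => l _.
rewrite -sumrN; apply: eq_bigr => m lm.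
rewrite -mulrN -(omit2_lt _ lm) /G (omit2C s m); congr (_ * _).
have lw := form_mlin fw.
rewrite (mlinD [::] _ _ _ lw) -[- D _ _]scaleN1r (mlinZ [::] _ _ _ lw).
by rewrite mulN1r opprD opprK addrC.
Qed.

End PairOmission.

(** * Forms acting through Clifford multiplication *)

(** Adjacent transpositions generate all rearrangements; repeated entries need no
    transposition. *)
Lemma perm_swap_invariant (T : eqType) (X : Type) (G : seq T -> X) :
    (forall s1 x y s2, x != y -> G (s1 ++ x :: y :: s2) = G (s1 ++ y :: x :: s2)) ->
  forall s t, perm_eq s t -> G s = G t.
Proof.
move=> swapG.
have bubble x t1 : forall pre t2,
    G (pre ++ x :: t1 ++ t2) = G (pre ++ t1 ++ x :: t2).
  elim: t1 => [//|y t1 IH] pre t2 /=.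
  have -> : G (pre ++ x :: y :: t1 ++ t2) = G (pre ++ y :: x :: t1 ++ t2).
    by have [->//|xy] := eqVneq x y; rewrite swapG.
  by rewrite -[LHS](congr1 G (cat_rcons y pre _)) IH cat_rcons.
suff H s : forall pre t, perm_eq s t -> G (pre ++ s) = G (pre ++ t).
  by move=> s t st; exact: (H s [::] t st).
elim: s => [|x s IH] pre t.
  by move/perm_size/esym/size0nil ->.
move=> st; have xt : x \in t by rewrite -(perm_mem st) mem_head.
case/splitPr: xt st => t1 t2 st.
have {}st : perm_eq s (t1 ++ t2).
  by rewrite -(perm_cons x) (permPl st) -cat1s perm_catCA.
by rewrite -cat_rcons (IH _ _ st) cat_rcons bubble.
Qed.

Section CliffordAction.
Context {R : realType} {V : lmodType R} {W : lmodType R[i]}.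

Definition rlin (f : V -> W) : Prop :=
  forall a u v, f (a *: u + v) = a%:C *: f u + f v.

Lemma rlin0 (f : V -> W) : rlin f -> f 0 = 0.
Proof.
move=> lf; have := lf (-1) 0 0; rewrite scaler0 addr0.
rewrite rmorphN rmorph1 scaleN1r => ->; exact: addNr.
Qed.

Lemma rlinD (f : V -> W) u v : rlin f -> f (u + v) = f u + f v.
Proof. by move=> lf; rewrite -[u]scale1r lf rmorph1 !scale1r. Qed.

Lemma rlinZ (f : V -> W) a u : rlin f -> f (a *: u) = a%:C *: f u.
Proof. by move=> lf; rewrite -[_ *: _]addr0 lf rlin0 // addr0. Qed.

Lemma rlin_sum (f : V -> W) (I : finType) (P : pred I) (F : I -> V) : rlin f ->
  f (\sum_(i | P i) F i) = \sum_(i | P i) f (F i).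
Proof.
by move=> lf; apply: big_morph => [u v|]; [exact: rlinD | exact: rlin0].
Qed.

(** Stated for abstract modules, so as to apply to spinors as well as to spin
    tractors. *)
Record clifford_action (ip : V -> V -> R) (c : V -> W -> W) : Prop :=
  CliffordAction {
  cact_vec : forall z, rlin (c^~ z);
  cact_lin : forall v, linear (c v);
  cact_anti : forall u v z, c u (c v z) + c v (c u z) = (- 2 * ip u v)%:C *: z
}.

Section Frames.
Context {m : nat}.
Variable (ip : V -> V -> R) (e : 'I_m -> R).

(** The expansion of vectors in the pseudo-orthonormal frame [b] with signs [e]. *)
Definition resolves (b : 'I_m -> V) : Prop :=
  forall u, u = \sum_i (e i * ip u (b i)) *: b i.

Hypothesis ipC : forall u v, ip u v = ip v u.

(** Both sides are the contraction of [B] with the metric: expand the first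
    argument in one frame and the second argument in the other. *)
Lemma contraction_indep (b b' : 'I_m -> V) (B : V -> V -> W) :
    resolves b -> resolves b' ->
    (forall u, rlin (B u)) -> (forall u, rlin (B^~ u)) ->
  \sum_i (e i)%:C *: B (b i) (b i) = \sum_i (e i)%:C *: B (b' i) (b' i).
Proof.
move=> rb rb' Br Bl.
transitivity (\sum_i \sum_j (e i * e j * ip (b i) (b' j))%:C *: B (b' j) (b i)).
  apply: eq_bigr => i _; rewrite {1}[b i]rb' (rlin_sum _ _ (Bl _)) scaler_sumr.
  apply: eq_bigr => j _.
  by rewrite (rlinZ _ _ (Bl _)) scalerA -rmorphM mulrA.
rewrite exchange_big; apply: eq_bigr => j _.
rewrite {4}[b' j]rb (rlin_sum _ _ (Br _)) scaler_sumr.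
apply: eq_bigr => i _.
by rewrite (rlinZ _ _ (Br _)) scalerA -rmorphM mulrA [e j * _]mulrC ipC.
Qed.

(** The infinitesimal form of the invariance of the contraction under
    isometries. *)
Lemma contraction_skew (b : 'I_m -> V) (L : V -> V) (B : V -> V -> W) :
    resolves b -> (forall u v, ip (L u) v = - ip u (L v)) ->
    (forall u, rlin (B u)) -> (forall u, rlin (B^~ u)) ->
  \sum_i (e i)%:C *: (B (L (b i)) (b i) + B (b i) (L (b i))) = 0.
Proof.
move=> rb skewL Br Bl.
under eq_bigr do rewrite scalerDr.
rewrite big_split /=.
have E1 : \sum_i (e i)%:C *: B (L (b i)) (b i) =
    \sum_i \sum_j (e i * e j * ip (L (b i)) (b j))%:C *: B (b j) (b i).
  apply: eq_bigr => i _; rewrite {1}[L (b i)]rb (rlin_sum _ _ (Bl _)) scaler_sumr.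
  by apply: eq_bigr => j _; rewrite (rlinZ _ _ (Bl _)) scalerA -rmorphM mulrA.
have E2 : \sum_i (e i)%:C *: B (b i) (L (b i)) =
    \sum_i \sum_j (e i * e j * ip (L (b i)) (b j))%:C *: B (b i) (b j).
  apply: eq_bigr => i _; rewrite {1}[L (b i)]rb (rlin_sum _ _ (Br _)) scaler_sumr.
  by apply: eq_bigr => j _; rewrite (rlinZ _ _ (Br _)) scalerA -rmorphM mulrA.
rewrite E1 E2 exchange_big -big_split /=; apply: big1 => i _.
rewrite -big_split /=; apply: big1 => j _.
by rewrite skewL ipC -scalerDl -rmorphD mulrN [e j * _]mulrC addNr scale0r.
Qed.

End Frames.

Section Contr.
Context {m : nat}.
Variable (e : 'I_m -> R) (b : 'I_m -> V) (c : V -> W -> W).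

(** The action of forms of degree [d], up to the factor [d!]: a sum over all words
    of length [d] in the frame, hence an iterated metric contraction. *)
Fixpoint contr (d : nat) (w : seq V -> R) (z : W) : W :=
  if d is d'.+1 then
    \sum_i (e i)%:C *: c (b i) (contr d' (hook (b i) w) z)
  else (w [::])%:C *: z.

Lemma eq_contr d w w' z : w =1 w' -> contr d w z = contr d w' z.
Proof. by move=> ww'; congr contr; apply/funext. Qed.

Lemma form_act_deg0 w z : is_form 0 w -> form_act b e c w z = (w [::])%:C *: z.
Proof.
move=> fw; rewrite /form_act (bigD1 (finset.set0 : {set 'I_m})) //= enum_set0.
rewrite big_set0 mul1r big1 ?addr0 // => A A0.
rewrite (form_size fw) ?mulr0 ?(rmorph0 (real_complex R)) ?scale0r //.
by rewrite size_map -cardE eqz_nat cards_eq0.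
Qed.

Section FormAct.
Hypothesis clin : forall v, linear (c v).
Hypothesis canti :
  forall i j z, i != j -> c (b i) (c (b j) z) = - c (b j) (c (b i) z).

(** The Clifford product of [b i] with [hook (b i) w] is the exterior one, as
    [hook (b i) (hook (b i) w)] is zero.  Each set B of frame vectors thus arises
    once from each of its elements i, by joining i to the other ones. *)
Lemma form_act_rec (d : int) w z : is_form d w ->
  d%:~R *: form_act b e c w z =
  \sum_i (e i)%:C *: c (b i) (form_act b e c (hook (b i) w) z).
Proof.
move=> fw.
(* [G] does not depend on the order of its argument, which makes the signs of
   rearrangements disappear from the count. *)
pose G (s : seq 'I_m) : W :=
  (w [seq b i | i <- s])%:C *: foldr (fun i => c (b i)) z s.
have Gperm s t : perm_eq s t -> G s = G t.
  apply: perm_swap_invariant => s1 x y s2 xy; rewrite /G !map_cat /= !foldr_cat /=.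
  rewrite canti // (form_swap _ _ _ _ fw).
  have -> z' : foldr (fun i => c (b i)) (- z') s1 =
      - foldr (fun i => c (b i)) z' s1.
    by elim: s1 => [//|i s1 IH] /=; rewrite IH (linN (clin _)).
  by rewrite rmorphN scalerN scaleNr opprK.
transitivity (\sum_(A : {set 'I_m}) \sum_(i in A) (\prod_(j in A) e j)%:C *: G (enum A)).
  rewrite /form_act scaler_sumr; apply: eq_bigr => A _.
  rewrite sumr_const -scaler_nat.
  have [->|sA] := eqVneq d #|A|%:Z.
    by congr (_ *: _); rewrite /G scalerA -rmorphM.
  rewrite /G (form_size fw) ?mulr0 ?rmorph0 ?scale0r ?scaler0 //.
  by rewrite size_map -cardE eq_sym.
under [RHS]eq_bigr => i _.
  rewrite /form_act (lin_sum (clin _)) scaler_sumr.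
  under eq_bigr => A _.
    rewrite (linZ (clin _)) scalerA -rmorphM mulrA.
    rewrite -[_ *: _]/((e i * _ * _)%:C *:
      foldr (fun i => c (b i)) z (i :: enum A)).
    rewrite [X in X *: _]rmorphM /= -scalerA.
    rewrite -[X in _ *: X]/(G (i :: enum A)).
    over.
  rewrite (bigID (fun A : {set 'I_m} => i \in A)) /= big1 ?add0r; last first.
    move=> A iA; rewrite /G /= (form_dup_mem fw) ?rmorph0 ?scale0r ?scaler0 //.
    by apply: map_f; rewrite mem_enum.
  over.
rewrite (exchange_big_dep xpredT) //=; apply: eq_bigr => i _.
rewrite (reindex_onto (fun A => i |: A) (fun A => A :\ i)) /=; last first.
  by move=> A iA; rewrite finset.setD1K.
apply: eq_big => [A|A /andP[_ /eqP iA]].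
  rewrite finset.setU11 /=; apply/eqP/idP => [<-|iA]; first by rewrite !inE eqxx.
  by rewrite finset.setU1K.
have {}iA : i \notin A by rewrite -iA !inE eqxx.
rewrite finset.big_setU1 //=; congr (_ *: _).
apply: Gperm; apply: uniq_perm; rewrite /= ?enum_uniq ?mem_enum ?iA //.
by move=> j; rewrite !inE !mem_enum !inE.
Qed.

Lemma form_act_contr d w z : is_form d%:Z w ->
  (d`!)%:R *: form_act b e c w z = contr d w z.
Proof.
elim: d w => [|d IH] w fw.
  by rewrite fact0 scale1r form_act_deg0.
rewrite factS mulnC natrM -scalerA -[d.+1%:R]/(d.+1%:~R) (form_act_rec _ fw).
rewrite scaler_sumr /=.
apply: eq_bigr => i _; rewrite scalerA mulrC -scalerA -(linZ (clin _)) IH //.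
by have := form_hook (b i) fw; suff -> : d.+1%:Z - 1 = d%:Z by []; lia.
Qed.

End FormAct.
End Contr.

End CliffordAction.

Section FormActLinear.
Context {R : realType} {V : lmodType R} {W : lmodType R[i]} {m : nat}.
Variables (e : 'I_m -> R) (b : 'I_m -> V) (c : V -> W -> W).

Lemma form_act_form_linear a w w' z :
  form_act b e c (fun s => a * w s + w' s) z =
  a%:C *: form_act b e c w z + form_act b e c w' z.
Proof.
rewrite /form_act scaler_sumr -big_split; apply: eq_bigr => A _.
by rewrite mulrDr rmorphD scalerDl mulrCA rmorphM scalerA.
Qed.

Lemma eq_form_act w w' z : w =1 w' -> form_act b e c w z = form_act b e c w' z.
Proof. by move=> ww'; congr form_act; apply/funext. Qed.

Lemma form_act0 w z : (forall s, w s = 0) -> form_act b e c w z = 0.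
Proof.
by move=> w0; rewrite /form_act big1 // => A _; rewrite w0 mulr0 rmorph0 scale0r.
Qed.

Lemma form_actN w z :
  form_act b e c (fun s => - w s) z = - form_act b e c w z.
Proof.
rewrite (eq_form_act (w' := fun s => -1 * w s + 0)) => [|s].
  rewrite form_act_form_linear rmorphN rmorph1 scaleN1r.
  by rewrite (form_act0 z (w := fun=> 0)) ?addr0.
by rewrite mulN1r addr0.
Qed.

Lemma form_act_hook_rlin w z : mlin w ->
  rlin (fun u => form_act b e c (hook u w) z).
Proof.
move=> lw a u v; rewrite -form_act_form_linear; apply: eq_form_act => s.
exact: (lw [::]).
Qed.

End FormActLinear.

Section FormActSpinor.
Context {R : realType} {V : lmodType R} {W : lmodType R[i]} {m : nat}.
Variables (e : 'I_m -> R) (b : 'I_m -> V) (c : V -> W -> W).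
Hypothesis clin : forall v, linear (c v).

Lemma form_act_linear w : linear (form_act b e c w).
Proof.
move=> a z z'; rewrite /form_act scaler_sumr -big_split; apply: eq_bigr => A _ /=.
have -> : foldr (fun i => c (b i)) (a *: z + z') (enum A) =
    a *: foldr (fun i => c (b i)) z (enum A) + foldr (fun i => c (b i)) z' (enum A).
  by elim: (enum A) => [//|i s /= ->]; rewrite clin.
by rewrite scalerDr !scalerA mulrC.
Qed.

Lemma form_act_frame_scale r w w' z :
    (forall s : seq 'I_m, w (map b s) = r * w' (map b s)) ->
  form_act b e c w z = r%:C *: form_act b e c w' z.
Proof.
move=> ww'; rewrite /form_act scaler_sumr; apply: eq_bigr => A _.
by rewrite ww' mulrCA rmorphM scalerA.
Qed.

End FormActSpinor.

(** * Invariance of the action under isometries and skew maps *)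

Section ContrTransport.
Context {R : realType} {V : lmodType R} {W : lmodType R[i]} {m : nat}.
Variables (ip : V -> V -> R) (e : 'I_m -> R) (b : 'I_m -> V) (c : V -> W -> W).
Hypothesis ca : clifford_action ip c.

Let clin v : linear (c v) := cact_lin ca v.

Lemma contr_form_linear d a w w' z :
  contr e b c d (fun s => a * w s + w' s) z =
  a%:C *: contr e b c d w z + contr e b c d w' z.
Proof.
elim: d w w' => [|d IH] w w' /=.
  by rewrite rmorphD rmorphM scalerDl scalerA.
rewrite scaler_sumr -big_split /=; apply: eq_bigr => i _.
by rewrite IH clin scalerDr scalerA mulrC -scalerA.
Qed.

Lemma contr_linear d w : linear (contr e b c d w).
Proof.
elim: d w => [|d IH] w a z z' /=.
  by rewrite scalerDr scalerA mulrC -scalerA.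
rewrite scaler_sumr -big_split /=; apply: eq_bigr => i _.
by rewrite IH clin scalerDr scalerA mulrC -scalerA.
Qed.

Lemma contr_hook_rlin d w z : mlin w ->
  rlin (fun u => contr e b c d (hook u w) z).
Proof.
move=> lw a u v; rewrite -contr_form_linear; apply: eq_contr => s.
exact: (lw [::]).
Qed.

Hypothesis ipC : forall u v, ip u v = ip v u.
Hypothesis rb : resolves ip e b.

(** The map [P] of spinors covers the isometry [g], which maps the frame [b] to
    another one; [w] is the pullback of [w']. *)
Lemma contr_intertwine (P : W -> W) (g : V -> V) d w w' z :
    linear P -> (forall v z, P (c v z) = c (g v) (P z)) ->
    resolves ip e (g \o b) -> mlin w' -> (forall s, w' (map g s) = w s) ->
  P (contr e b c d w z) = contr e b c d w' (P z).
Proof.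
move=> lP Pc rg; elim: d w w' => [|d IH] w w' lw' ww' /=.
  by rewrite (linZ lP) -ww'.
pose B u u' := c u (contr e b c d (hook u' w') (P z)).
rewrite (contraction_indep (B := B) ipC rb rg); first last.
- by move=> u; exact: cact_vec ca _.
- by move=> u a v v'; rewrite /B contr_hook_rlin // clin.
rewrite (lin_sum lP); apply: eq_bigr => i _.
rewrite (linZ lP) Pc /B /= (IH _ (hook (g (b i)) w')) //.
  exact: mlin_hook.
by move=> s; rewrite /hook -ww'.
Qed.

(** The operator [A] on spinors covers the skew map [L].  At each step,
    [contraction_skew] cancels the two terms in which [L] meets the frame. *)
Lemma contr_derivation (A : W -> W) (L : V -> V) d w z :
    linear A -> (forall v z, A (c v z) = c (L v) z + c v (A z)) ->
    (forall u v, ip (L u) v = - ip u (L v)) -> mlin w ->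
  contr e b c d (form_deriv L w) z + A (contr e b c d w z)
  = contr e b c d w (A z).
Proof.
move=> lA Ac skewL; elim: d w => [|d IH] w lw /=.
  by rewrite /form_deriv big_ord0 scale0r add0r (linZ lA).
pose B u u' := c u (contr e b c d (hook u' w) z).
have /= Beq0 := contraction_skew (B := B) ipC rb skewL _ _.
rewrite (lin_sum lA) -big_split /=.
transitivity (\sum_i (e i)%:C *: (B (L (b i)) (b i) + B (b i) (L (b i))) +
  \sum_i (e i)%:C *: c (b i) (contr e b c d (hook (b i) w) (A z))).
  rewrite -big_split /=; apply: eq_bigr => i _.
  rewrite (linZ lA) Ac -!scalerDr; congr (_ *: _).
  have -> : contr e b c d (fun s => form_deriv L w (b i :: s)) z =
      contr e b c d (hook (L (b i)) w) z
      + contr e b c d (form_deriv L (hook (b i) w)) z.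
    rewrite -[X in _ = X + _]scale1r -(rmorph1 (real_complex R)) -contr_form_linear.
    apply: eq_contr => s.
    by rewrite /form_deriv /= big_ord_recl mul1r.
  rewrite (linD (clin _)) -(IH (hook (b i) w)) ?(linD (clin _)).
    by rewrite /B addrACA [X in X + _]addrC.
  exact: mlin_hook.
rewrite Beq0 ?add0r //.
- by move=> u a v v'; rewrite /B contr_hook_rlin // clin.
- by move=> u; exact: cact_vec ca _.
Qed.

End ContrTransport.

Lemma resolves_isometry (R : realType) (V : lmodType R) (m : nat) (ip : V -> V -> R)
    (e : 'I_m -> R) (b : 'I_m -> V) (g g' : V -> V) :
    resolves ip e b -> linear g -> (forall u v, ip (g u) (g v) = ip u v) ->
    (forall u, g (g' u) = u) ->
  resolves ip e (g \o b).
Proof.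
move=> rb lg ig gK u; rewrite -{1}(gK u) [g' u]rb (lin_sum lg).
by apply: eq_bigr => i _; rewrite (linZ lg) -ig gK.
Qed.

(** * The tractor fibre and its spinors *)

Section Fibre.
Context {R : realType}.

Lemma eps_sqr (p i : nat) : eps p i * eps p i = 1 :> R.
Proof. by rewrite /eps; case: ifP => _; rewrite ?mulrNN mulr1. Qed.

Section Ip.
Variables (p n : nat).
Implicit Types (u v w : 'rV[R]_n).

Lemma ipC u v : ip p u v = ip p v u.
Proof. by apply: eq_bigr => i _; rewrite mulrAC. Qed.

Lemma ip_linl a u v w : ip p (a *: u + v) w = a * ip p u w + ip p v w.
Proof.
by rewrite /ip mulr_sumr -big_split; apply: eq_bigr => i _; rewrite !mxE /=; ring.
Qed.

Lemma ip0l w : ip p 0 w = 0.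
Proof. by rewrite /ip big1 // => i _; rewrite mxE mulr0 mul0r. Qed.

Lemma ip0r w : ip p w 0 = 0.
Proof. by rewrite ipC ip0l. Qed.

Lemma ipDl u v w : ip p (u + v) w = ip p u w + ip p v w.
Proof. by rewrite -[u]scale1r ip_linl scale1r mul1r. Qed.

Lemma ipZl a u w : ip p (a *: u) w = a * ip p u w.
Proof. by rewrite -[_ *: u]addr0 ip_linl ip0l addr0. Qed.

Lemma ipDr u v w : ip p w (u + v) = ip p w u + ip p w v.
Proof. by rewrite ipC ipDl !(ipC w). Qed.

Lemma ipZr a u w : ip p w (a *: u) = a * ip p w u.
Proof. by rewrite ipC ipZl (ipC w). Qed.

Lemma ip_delta v (a : 'I_n) : ip p v (delta_mx 0 a) = eps p a * v 0 a.
Proof.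
rewrite /ip (bigD1 a) //= big1 ?addr0.
  by rewrite mxE !eqxx mulr1.
by move=> i ia; rewrite mxE eqxx (negPf ia) mulr0.
Qed.

Lemma resolves_delta :
  resolves (@ip R p n) (fun a : 'I_n => eps p a) (fun a => delta_mx 0 a).
Proof.
move=> u; rewrite {1}[u]row_sum_delta; apply: eq_bigr => a _.
by rewrite ip_delta mulrA eps_sqr mul1r.
Qed.

End Ip.

Section TractorIp.
Variables (p n : nat).
Implicit Types t : tractor R n.

Lemma tractor_ipC t1 t2 : tractor_ip p t1 t2 = tractor_ip p t2 t1.
Proof.
case: t1 => [[a1 Y1] b1]; case: t2 => [[a2 Y2] b2] /=.
by rewrite (ipC p Y1 Y2); ring.
Qed.

Lemma tractor_linE (a : R) (a1 b1 a2 b2 : R) (Y1 Y2 : 'rV[R]_n) :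
  a *: ((a1, Y1, b1) : tractor R n) + (a2, Y2, b2) =
  (a * a1 + a2, a *: Y1 + Y2, a * b1 + b2).
Proof. by []. Qed.

Lemma tractor_scaleE (a a1 b1 : R) (Y1 : 'rV[R]_n) :
  a *: ((a1, Y1, b1) : tractor R n) = (a * a1, a *: Y1, a * b1).
Proof. by []. Qed.

Lemma tractor_ip_linl a t1 t2 t :
  tractor_ip p (a *: t1 + t2) t = a * tractor_ip p t1 t + tractor_ip p t2 t.
Proof.
case: t1 => [[a1 Y1] b1]; case: t2 => [[a2 Y2] b2]; case: t => [[a3 Y3] b3].
by rewrite tractor_linE /= ip_linl; ring.
Qed.

Lemma unlift_ord_max_lift (a : 'I_n) :
  unlift ord_max (widen_ord (leqnSn n) a) = Some a.
Proof.
have -> : widen_ord (leqnSn n) a = lift ord_max a.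
  by apply: val_inj; rewrite /= /bump leqNgt ltn_ord.
by rewrite liftK.
Qed.

(** The first and the last vectors of the basis span the same hyperbolic plane as
    the isotropic vectors s_- and s_+, whose metric contraction is
    s_- (x) s_+ + s_+ (x) s_-. *)
Lemma contraction_tractor_basis (W : lmodType R[i])
    (B : tractor R n -> tractor R n -> W) : (p <= n)%N ->
    (forall u, rlin (B u)) -> (forall u, rlin (B^~ u)) ->
  \sum_(i < n.+2) (eps p.+1 i : R)%:C *: B (tractor_basis i) (tractor_basis i) =
  B s_minus s_plus + B s_plus s_minus
  + \sum_(a < n) (eps p a : R)%:C *: B (0, delta_mx 0 a, 0) (0, delta_mx 0 a, 0).
Proof.
move=> pn Br Bl; rewrite big_ord_recl big_ord_recr /=.
have -> : tractor_basis ord0 =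
    (Num.sqrt 2)^-1 *: (-1 *: s_minus + s_plus) :> tractor R n.
  rewrite /tractor_basis unlift_none /s_minus /s_plus tractor_linE.
  by rewrite tractor_scaleE !(scaler0, mulr0, addr0, add0r, mulr1, mulrN1).
have -> : tractor_basis (lift ord0 ord_max) =
    (Num.sqrt 2)^-1 *: (1 *: s_minus + s_plus) :> tractor R n.
  rewrite /tractor_basis liftK unlift_none /s_minus /s_plus tractor_linE.
  by rewrite tractor_scaleE !(scaler0, mulr0, addr0, add0r, mulr1, mulrN1).
have -> : eps p.+1 (@ord0 n.+1) = -1 :> R by [].
have -> : eps p.+1 (lift ord0 (@ord_max n)) = 1 :> R.
  by rewrite /eps /= /bump /= add1n ltnS ltnNge pn.
rewrite addrCA addrC; congr (_ + _); last first.
  apply: eq_bigr => a _; rewrite /tractor_basis liftK unlift_ord_max_lift.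
  by rewrite /eps /= /bump /= add1n ltnS.
rewrite !(rlinZ _ _ (Bl _)) !(rlinZ _ _ (Br _)) !Bl !Br.
have E : ((Num.sqrt 2)^-1)%:C * ((Num.sqrt 2)^-1)%:C = (2^-1 : R)%:C.
  by rewrite -rmorphM -invfM -expr2 sqr_sqrtr.
rewrite !rmorphN !rmorph1 !scale1r !scaleN1r !scalerA ?E.
set X := B s_minus s_plus; set Y := B s_plus s_minus.
set U := B s_minus s_minus; set Z := B s_plus s_plus.
by linear_identity_by R[i] W ltac:(by field).
Qed.

End TractorIp.
End Fibre.

Section TractorFrame.
Context {R : realType} {p n : nat}.

Definition tangent_tractor (Y : 'rV[R]_n) : tractor R n := (0, Y, 0).

Lemma tangent_tractor_linear : linear tangent_tractor.
Proof. by move=> a u v; rewrite /tangent_tractor tractor_linE mulr0 addr0. Qed.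

Hypothesis pn : (p <= n)%N.

(** It suffices to test linear functionals [f], and then
    [contraction_tractor_basis] applies to [<t, u> f v]. *)
Lemma resolves_tractor_basis :
  resolves (@tractor_ip R p n) (fun i : 'I_n.+2 => eps p.+1 i) tractor_basis.
Proof.
move=> t.
suff H (f : tractor R n -> R) :
    (forall a u v, f (a *: u + v) = a * f u + f v) ->
    f t = f (\sum_(i < n.+2) (eps p.+1 i * tractor_ip p t (tractor_basis i)) *:
               tractor_basis i).
  set t' := \sum_i _ in H *.
  have /= H1 := H (fun u => u.1.1) (fun _ _ _ => erefl).
  have /= H3 := H (fun u => u.2) (fun _ _ _ => erefl).
  have H2 : t.1.2 = t'.1.2.
    by apply/rowP => m; apply: (H (fun u => u.1.2 0 m)) => a u v /=; rewrite !mxE.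
  by case: t {H} t' H1 H2 H3 => [[? ?] ?] [[? ?] ?] /= -> -> ->.
move=> lf; have lf' : linear (f : tractor R n -> R^o) by exact: lf.
rewrite (lin_sum lf').
pose B (u v : tractor R n) : (R[i])^o := (tractor_ip p t u * f v)%:C.
have Br u : rlin (B u).
  move=> a v v'; rewrite /B lf -[RHS]/(_ * _ + _) -rmorphM -rmorphD.
  by congr (_%:C); ring.
have Bl u : rlin (B^~ u).
  move=> a v v'; rewrite /B !(tractor_ipC p t) tractor_ip_linl.
  by rewrite -[RHS]/(_ * _ + _) -rmorphM -rmorphD; congr (_%:C); ring.
apply: (@complexI R).
transitivity (\sum_(i < n.+2)
    (eps p.+1 i : R)%:C *: B (tractor_basis i) (tractor_basis i)).
  rewrite (contraction_tractor_basis pn Br Bl).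
  case: t @B {Br Bl} => [[a Y] b] B.
  have -> : (a, Y, b) = a *: s_minus + (b *: s_plus +
      \sum_(j < n) Y 0 j *: (0, delta_mx 0 j, 0)) :> tractor R n.
    rewrite /s_minus /s_plus [X in _ + (_ + X)](_ : _ = (0, Y, 0)).
      rewrite !tractor_linE !(scaler0, mulr0, mulr1, addr0, add0r).
      by rewrite tractor_scaleE !(scaler0, mulr0, mulr1, addr0, add0r).
    rewrite [in RHS](row_sum_delta Y).
    rewrite -[RHS]/(tangent_tractor _) (lin_sum tangent_tractor_linear).
    apply: eq_bigr => j _.
    by rewrite (linZ tangent_tractor_linear).
  rewrite lf (linD lf') (linZ lf') (lin_sum lf') /B.
  rewrite !rmorphD /= addrCA addrA; congr (_ + _ + _).
  - by rewrite /s_minus /= !ip0r !(mulr0, addr0, mulr1, add0r, mul1r).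
  - by rewrite /s_plus /= !ip0r !(mulr0, mul0r, addr0, mulr1, add0r).
  rewrite rmorph_sum; apply: eq_bigr => j _.
  rewrite (linZ lf') -[RHS]/(_ * _) -rmorphM ip_delta !(mulr0, mul0r, add0r).
  by rewrite !mulrA eps_sqr mul1r.
rewrite rmorph_sum; apply: eq_bigr => j _.
by rewrite (linZ lf') /B -[LHS]/(_ * _) -rmorphM mulrA.
Qed.

End TractorFrame.

Section DoubleAction.
Context {R : realType} {p n : nat} {W : lmodType R[i]}.
Variable c : 'rV[R]_n -> W -> W.

(** The Clifford action of tractors on pairs of spinors, with spinors taken in an
    abstract Clifford module. *)
Definition double_cl (t : tractor R n) (z : (W * W)%type) : (W * W)%type :=
  let: (a, Y, b) := t in let: (z1, z2) := z in
  (- c Y z1 - (2 * b)%:C *: z2, c Y z2 + a%:C *: z1).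

Hypothesis ca : clifford_action (@ip R p n) c.

Lemma double_cl_action : clifford_action (@tractor_ip R p n) double_cl.
Proof.
have cl_linear := cact_lin ca.
have cD v := linD (cl_linear v); have cZ v := linZ (cl_linear v).
have cN v := linN (cl_linear v).
split.
- move=> [z1 z2] a [[a1 Y1] b1] [[a2 Y2] b2].
  rewrite tractor_linE /double_cl.
  rewrite -[RHS]/(a%:C *: (- c Y1 z1 - (2 * b1)%:C *: z2) +
       (- c Y2 z1 - (2 * b2)%:C *: z2),
       a%:C *: (c Y1 z2 + a1%:C *: z1) + (c Y2 z2 + a2%:C *: z1)).
  rewrite !(cact_vec ca).
  move: (c Y1 z1) (c Y1 z2) (c Y2 z1) (c Y2 z2) => A1 A2 A3 A4.
  by congr (_, _); linear_identity R[i] W.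
- move=> [[a Y] b] k [z1 z2] [y1 y2].
  rewrite -[X in double_cl _ X]/(k *: z1 + y1, k *: z2 + y2) /double_cl.
  rewrite -[RHS]/(k *: (- c Y z1 - (2 * b)%:C *: z2) +
       (- c Y y1 - (2 * b)%:C *: y2),
       k *: (c Y z2 + a%:C *: z1) + (c Y y2 + a%:C *: y1)).
  rewrite !cl_linear.
  move: (c Y z1) (c Y z2) (c Y y1) (c Y y2) => A1 A2 A3 A4.
  by congr (_, _); linear_identity R[i] W.
move=> [[a1 Y1] b1] [[a2 Y2] b2] [z1 z2].
rewrite /double_cl.
rewrite -[LHS]/(- c Y1 (- c Y2 z1 - (2 * b2)%:C *: z2)
    - (2 * b1)%:C *: (c Y2 z2 + a2%:C *: z1)
    + (- c Y2 (- c Y1 z1 - (2 * b1)%:C *: z2)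
    - (2 * b2)%:C *: (c Y1 z2 + a1%:C *: z1)),
    c Y1 (c Y2 z2 + a2%:C *: z1) + a1%:C *: (- c Y2 z1 - (2 * b2)%:C *: z2)
    + (c Y2 (c Y1 z2 + a1%:C *: z1) + a2%:C *: (- c Y1 z1 - (2 * b1)%:C *: z2))).
rewrite -[RHS]/((- 2 * tractor_ip p (a1, Y1, b1) (a2, Y2, b2))%:C *: z1,
  (- 2 * tractor_ip p (a1, Y1, b1) (a2, Y2, b2))%:C *: z2).
have E z := cact_anti ca Y1 Y2 z.
congr (_, _) => /=.
- rewrite !(cD, cZ, cN) (_ : (- 2 * (a1 * b2 + a2 * b1 + ip p Y1 Y2))%:C =
    (- 2 * ip p Y1 Y2)%:C - (2 * b1)%:C * a2%:C - (2 * b2)%:C * a1%:C); last first.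
    by rewrite -!rmorphM -!rmorphB; congr (_%:C); ring.
  rewrite !scalerBl -E.
  move: (c Y1 (c Y2 z1)) (c Y2 (c Y1 z1)) (c Y1 z2) (c Y2 z2).
  by move=> A1 A2 A3 A4; linear_identity R[i] W.
- rewrite !(cD, cZ, cN) (_ : (- 2 * (a1 * b2 + a2 * b1 + ip p Y1 Y2))%:C =
    (- 2 * ip p Y1 Y2)%:C - (2 * b1)%:C * a2%:C - (2 * b2)%:C * a1%:C); last first.
    by rewrite -!rmorphM -!rmorphB; congr (_%:C); ring.
  rewrite !scalerBl -E.
  move: (c Y1 (c Y2 z2)) (c Y2 (c Y1 z2)) (c Y1 z1) (c Y2 z1).
  by move=> A1 A2 A3 A4; linear_identity R[i] W.
Qed.

End DoubleAction.

(** * The action of a tractor form in terms of its components *)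

Section ComponentAction.
Context {R : realType} {p q : nat} {W : lmodType R[i]}.
Local Notation n := (p + q)%N.
Local Notation trac := (tractor R n).
Local Notation vec := 'rV[R]_n.
Variable c : vec -> W -> W.
Hypothesis ca : clifford_action (@ip R p n) c.

Local Notation vec_act := (form_act (fun a : 'I_n => delta_mx 0 a) (fun a => eps p a) c).
Local Notation trac_act :=
  (form_act (@tractor_basis R n) (fun i => eps p.+1 i) (double_cl c)).

Lemma vec_act_rec (d : int) (w : seq vec -> R) (z : W) :
    is_form d w ->
  d%:~R *: vec_act w z =
  \sum_(a < n) (eps p a)%:C *:
     c (delta_mx 0 a) (vec_act (hook (delta_mx 0 a) w) z).
Proof.
apply: form_act_rec => [v|i j y ij]; first exact: cact_lin ca v.
apply/eqP; rewrite -addr_eq0 (cact_anti ca) ip_delta mxE.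
by rewrite eqxx [j == i]eq_sym (negPf ij) !mulr0 (rmorph0 (real_complex R)) scale0r.
Qed.

Lemma tractor_basis_orthogonal (i j : 'I_n.+2) : i != j ->
  tractor_ip p (tractor_basis i) (tractor_basis j) = 0 :> R.
Proof.
have s2 : (Num.sqrt 2)^-1 * (Num.sqrt 2)^-1 = 2^-1 :> R.
  by rewrite -invfM -expr2 sqr_sqrtr.
rewrite /tractor_basis.
case: (unliftP ord0 i) => [i'|] ->; case: (unliftP ord0 j) => [j'|] ->.
- rewrite (inj_eq lift_inj).
  case: (unliftP ord_max i') => [i''|] ->; case: (unliftP ord_max j') => [j''|] ->.
  + rewrite (inj_eq lift_inj) /= => ij.
    rewrite !(mulr0, mul0r, add0r) ip_delta mxE eqxx [j'' == _]eq_sym (negPf ij).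
    by rewrite !mulr0.
  + by move=> _ /=; rewrite ip0r !(mulr0, mul0r, add0r).
  + by move=> _ /=; rewrite ip0l !(mulr0, mul0r, add0r).
  + by rewrite eqxx.
- move=> _; case: (unliftP ord_max i') => [i''|] _ /=.
    by rewrite ip0r !(mulr0, mul0r, add0r).
  by rewrite ip0r addr0 mulNr subrr.
- move=> _; case: (unliftP ord_max j') => [j''|] _ /=.
    by rewrite ip0l !(mulr0, mul0r, add0r).
  by rewrite ip0r addr0 mulNr addNr.
- by rewrite eqxx.
Qed.

Lemma trac_act_rec (d : int) (w : seq trac -> R) (z : (W * W)%type) :
    is_form d w ->
  d%:~R *: trac_act w z =
  double_cl c s_minus (trac_act (hook s_plus w) z)
  + double_cl c s_plus (trac_act (hook s_minus w) z)
  + \sum_(a < n) (eps p a)%:C *: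
      double_cl c (tangent_tractor (delta_mx 0 a))
        (trac_act (hook (tangent_tractor (delta_mx 0 a)) w) z).
Proof.
move=> fw; have dca := double_cl_action ca.
rewrite (@form_act_rec _ _ _ _ _ _ _ (cact_lin dca) _ d) //; last first.
  move=> i j y ij; apply/eqP; rewrite -addr_eq0 (cact_anti dca).
  by rewrite tractor_basis_orthogonal // mulr0 (rmorph0 (real_complex R)) scale0r.
pose B (u u' : trac) := double_cl c u (trac_act (hook u' w) z).
apply: (contraction_tractor_basis (B := B)) => [|u|u].
- exact: leq_addr.
- move=> a v v'; rewrite /B form_act_hook_rlin.
    by rewrite (cact_lin dca).
  exact: form_mlin fw.
- exact: cact_vec dca _.
Qed.

Lemma vec_act_neg (d : int) (w : seq vec -> R) (z : W) : d < 0 ->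
  is_form d w -> vec_act w z = 0.
Proof.
move=> d0 fw; apply: form_act0 => s; apply: (form_size fw).
by apply/negP => /eqP sd; move: d0; rewrite -sd.
Qed.

(** The graded Leibniz rule, with s_+^flat and s_-^flat taking the values [a] and
    [b] on a s_- + Y + b s_+. *)
Lemma components_hook (alpha : seq trac -> R) (ap a0 amp am : seq vec -> R)
    (a b : R) (Y : vec) :
    tractor_components alpha ap a0 amp am ->
  tractor_components (hook (a, Y, b) alpha)
    (fun s => b * amp s + - hook Y ap s)
    (fun s => a * ap s + (b * am s + hook Y a0 s))
    (hook Y amp)
    (fun s => - a * amp s + - hook Y am s).
Proof.
rewrite /tractor_components /hook /= => comp s.
rewrite comp /= !wedge1_cons.
have -> : tractor_ip p s_plus ((a, Y, b) : trac) = a.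
  by rewrite /= ip0l mul0r add0r mulr1 addr0.
have -> : tractor_ip p s_minus ((a, Y, b) : trac) = b.
  by rewrite /= ip0l mulr0 mul1r !addr0.
set sp := tractor_ip p s_plus; set sm := tractor_ip p s_minus.
have neg (theta : trac -> R) (w : seq trac -> R) s' :
    wedge1 theta (fun s => - w s) s' = - wedge1 theta w s'.
  by rewrite -mulN1r -wedge1Z; apply: eq_wedge1 => ?; rewrite mulN1r.
rewrite !wedge1_linear !neg.
have E s' : wedge1 sp (fun s => amp [seq t.1.2 | t <- s]) ((a, Y, b) :: s') =
     a * amp [seq t.1.2 | t <- s'] +
     - wedge1 sp (fun s => amp (Y :: [seq t.1.2 | t <- s])) s'.
  rewrite wedge1_cons.
  by rewrite (_ : sp _ = a) // /sp /= ip0l mul0r add0r mulr1 addr0.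
rewrite (eq_wedge1 _ E).
rewrite wedge1_linear neg; ring.
Qed.

(** Induction on the degree by [trac_act_rec]; it involves both components at once,
    as s_+ moves the second one to the first place. *)
Lemma components_act (d : nat) (alpha : seq trac -> R) (ap a0 amp am : seq vec -> R)
    (z1 z2 : W) :
    is_form d%:Z alpha -> is_form (d%:Z - 1) ap -> is_form d%:Z a0 ->
    is_form (d%:Z - 2) amp -> is_form (d%:Z - 1) am ->
    tractor_components alpha ap a0 amp am ->
  trac_act alpha ((z1, z2) : (W * W)%type) =
  (- 2%:R *: vec_act ap z2 + (-1) ^+ d *: vec_act amp z1
     + (-1) ^+ d *: vec_act a0 z1,
   vec_act a0 z2 - vec_act amp z2
     - (-1) ^+ d *: vec_act am z1).
Proof.
elim: d alpha ap a0 amp am => [|d IH] alpha ap a0 amp am falpha fap fa0 famp fam comp.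
  rewrite (vec_act_neg _ _ fap) // !(vec_act_neg _ _ famp) //.
  rewrite (vec_act_neg _ _ fam) // !form_act_deg0 //.
  rewrite (_ : alpha [::] = a0 [::]).
    by rewrite !scaler0 expr0 scale1r !add0r !subr0.
  by rewrite /tractor_components /= in comp; rewrite comp !wedge1_nil !addr0 add0r.
have d0 : (d.+1%:~R : R[i]) != 0 by rewrite intr_eq0.
apply: (scalerI d0); rewrite (trac_act_rec _ falpha).
have step (a b : R) (Y : vec) :
  trac_act (hook (a, Y, b) alpha) ((z1, z2) : (W * W)%type) =
  (- 2%:R *: (b%:C *: vec_act amp z2
        - vec_act (hook Y ap) z2)
     + (-1) ^+ d *: vec_act (hook Y amp) z1
     + (-1) ^+ d *: (a%:C *: vec_act ap z1
         + (b%:C *: vec_act am z1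
            + vec_act (hook Y a0) z1)),
   (a%:C *: vec_act ap z2
         + (b%:C *: vec_act am z2
            + vec_act (hook Y a0) z2))
     - vec_act (hook Y amp) z2
     - (-1) ^+ d *: ((- a)%:C *: vec_act amp z1
         - vec_act (hook Y am) z1)).
  rewrite (IH _ _ _ _ _ _ _ _ _ _ (components_hook a b Y comp)).
  - by rewrite !form_act_form_linear !form_actN.
  - by apply: form_hook_deg falpha _; lia.
  - apply: form_linear_comb; first by rewrite (_ : d%:Z - 1 = d.+1%:Z - 2) //; lia.
    by apply: form_opp; apply: form_hook_deg fap _; lia.
  - have E : d.+1%:Z - 1 = d%:Z by lia.
    apply: form_linear_comb; first by rewrite -E.
    apply: form_linear_comb; first by rewrite -E.
    exact: form_hook_deg fa0 _.
  - by apply: form_hook_deg famp _; lia.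
  - apply: form_linear_comb; first by rewrite (_ : d%:Z - 1 = d.+1%:Z - 2) //; lia.
    by apply: form_opp; apply: form_hook_deg fam _; lia.
have zero w r z : is_form r w -> vec_act (hook (0 : vec) w) z = 0 :> W.
  move=> fw; apply: form_act0 => s; exact: (mlin0 [::] s (form_mlin fw)).
have c0 z : c 0 z = 0 := rlin0 (cact_vec ca z).
have cD v := linD (cact_lin ca v); have cZ v := linZ (cact_lin ca v).
have cN v := linN (cact_lin ca v).
(* [T w z] is the degree of [w] times its action, by [vec_act_rec]. *)
pose T (w : seq vec -> R) z : W := \sum_(a < n) (eps p a)%:C *:
  c (delta_mx 0 a) (vec_act (hook (delta_mx 0 a) w) z).
have frameE :
  \sum_(a < n) (eps p a)%:C *: double_cl c (tangent_tractor (delta_mx 0 a))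
    (trac_act (hook (tangent_tractor (delta_mx 0 a)) alpha) ((z1, z2) : (W * W)%type))
  = (- 2%:R *: T ap z2 - (-1) ^+ d *: T amp z1 - (-1) ^+ d *: T a0 z1,
     T a0 z2 - T amp z2 + (-1) ^+ d *: T am z1) :> (W * W)%type.
  rewrite /T -!scaleNr !scaler_sumr -sumrN -!big_split /=.
  have sum_pair (F G : 'I_n -> W) :
      (\sum_a F a, \sum_a G a) = \sum_a ((F a, G a) : (W * W)%type).
    by elim/big_rec3: _ => //= a _ y1 y2 _ <-.
  rewrite sum_pair; apply: eq_bigr => a _.
  rewrite step /= !(cD, cN, cZ).
  rewrite pairZ.
  by congr (_, _); linear_identity R[i] W.
rewrite frameE !step /= !c0 /T -(vec_act_rec _ fap).
rewrite -!(vec_act_rec _ fa0) -!(vec_act_rec _ famp) -(vec_act_rec _ fam).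
rewrite !(zero _ _ _ fap, zero _ _ _ fa0, zero _ _ _ famp, zero _ _ _ fam).
have -> : (d.+1%:Z - 1)%:~R = d%:R :> R[i] by rewrite (_ : d.+1%:Z - 1 = d) //; lia.
have -> : (d.+1%:Z - 2)%:~R = d%:R - 1 :> R[i].
  by rewrite (_ : d.+1%:Z - 2 = d%:Z - 1) ?rmorphB //; lia.
have -> : d.+1%:~R = d%:R + 1 :> R[i] by rewrite -[LHS]/(d.+1%:R) -addn1 natrD.
rewrite exprS pairZ.
by congr (_, _) => /=; linear_identity R[i] W.
Qed.

End ComponentAction.

(** * Change of metric and covariant differentiation on the fibres *)

Section DoubleTransport.
Context {R : realType} {p n : nat} {W : lmodType R[i]}.
Variable c : 'rV[R]_n -> W -> W.
Hypothesis ca : clifford_action (@ip R p n) c.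
Local Notation vec := 'rV[R]_n.
Local Notation trac := (tractor R n).

Let cD v x y := linD (cact_lin ca v) x y.
Let cZ v a x := linZ (cact_lin ca v) a x.
Let cN v x := linN (cact_lin ca v) x.
Let cvD z u v : c (u + v) z = c u z + c v z := rlinD u v (cact_vec ca z).
Let cvZ z a u : c (a *: u) z = a%:C *: c u z := rlinZ a u (cact_vec ca z).

Lemma cact_swap u v z :
  c u (c v z) = (- 2 * ip p u v)%:C *: z - c v (c u z).
Proof. by rewrite -(cact_anti ca) addrK. Qed.

Lemma cact_sqr u z : c u (c u z) = (- ip p u u)%:C *: z.
Proof.
have := cact_anti ca u u z; move: (c u _) => y E.
rewrite -[y]halfK E scalerA -rmorphM; congr (_%:C *: _).
by rewrite mulNr mulrN mulrA mulVf ?mul1r // pnatr_eq0.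
Qed.

Section Rescale.
Variables (h : R) (h0 : h != 0) (ups : vec).

(** The effect on tractors of passing from the metric g to [h ^+ 4] times g, where
    [ups] is the gradient of the logarithm of [h ^+ 2]: spinors scale by the
    square root [h] of the length scale. *)
Definition rescale_tractor (t : trac) : trac :=
  let: (a, Y, b) := t in
  ((h * h)^-1 * (a - ip p Y ups - b / 2 * ip p ups ups), Y + b *: ups,
   (h * h) * b).

Definition rescale_spin (z : (W * W)%type) : (W * W)%type :=
  let: (z1, z2) := z in
  (h%:C *: z1, (h^-1)%:C *: (z2 - 2^-1 *: c ups z1)).

Lemma rescale_spin_linear : linear rescale_spin.
Proof.
move=> k [z1 z2] [y1 y2]; rewrite /rescale_spin !pairZ !pairD cD cZ.
by congr (_, _); linear_identity R[i] W.
Qed.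

Lemma rescale_intertwine t z :
  rescale_spin (double_cl c t z) = double_cl c (rescale_tractor t) (rescale_spin z).
Proof.
case: t => [[a Y] b]; case: z => z1 z2; rewrite /rescale_spin /rescale_tractor /=.
have hC0 : h%:C != 0 by rewrite -(rmorph0 (real_complex R)) (inj_eq (@complexI R)).
rewrite !(cvD, cvZ, cD, cN, cZ) (cact_swap Y) (cact_sqr ups).
congr (_, _).
  linear_identity_by R[i] W ltac:(field; exact: hC0).
by linear_identity_by R[i] W ltac:(field).
Qed.

End Rescale.

Section Derivation.
Variables (v kappa : vec) (N : vec -> vec) (Om : W -> W).
Hypotheses (Om_lin : linear Om) (Om_c : forall Y z, Om (c Y z) = c (N Y) z + c Y (Om z)).
Hypothesis N_skew : forall Y Y', ip p (N Y) Y' = - ip p Y (N Y').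

(** The tractor connection along [v] on tractors with constant components, where
    [kappa] is K(v) as a vector and [N] the Levi-Civita connection in the
    frame. *)
Definition tractor_conn_map (t : trac) : trac :=
  let: (a, Y, b) := t in
  (ip p kappa Y, N Y + a *: v - b *: kappa, - ip p v Y).

(** The spin tractor connection along [v] on pairs with constant components, where
    [Om] is the spin connection in the frame. *)
Definition spin_conn_map (z : (W * W)%type) : (W * W)%type :=
  let: (z1, z2) := z in (Om z1 - c v z2, Om z2 + 2^-1 *: c kappa z1).

Lemma spin_conn_map_linear : linear spin_conn_map.
Proof.
move=> k [z1 z2] [y1 y2]; rewrite /spin_conn_map !pairZ !pairD !Om_lin !cD !cZ.
by congr (_, _); linear_identity R[i] W.
Qed.

(** The two connections are compatible with Clifford multiplication; this reduces
    to the Clifford relations of [v] and of [kappa] with the tangent part of the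
    tractor. *)
Lemma conn_map_derivation t z :
  spin_conn_map (double_cl c t z) =
  double_cl c (tractor_conn_map t) z + double_cl c t (spin_conn_map z).
Proof.
have OD := linD Om_lin; have OZ := linZ Om_lin; have ON := linN Om_lin.
have cvN x u : c (- u) x = - c u x by rewrite -[- u]scaleN1r cvZ rmorphN rmorph1 scaleN1r.
case: t => [[a Y] b]; case: z => z1 z2; rewrite /spin_conn_map /tractor_conn_map /=.
rewrite !(cvD, cvN, cvZ, cD, cN, cZ, OD, OZ, ON, Om_c).
rewrite (cact_swap v) (cact_swap kappa) (ipC p kappa) (ipC p v) pairD.
by congr (_, _); linear_identity_by R[i] W ltac:(field).
Qed.

Lemma tractor_conn_map_skew t t' :
  tractor_ip p (tractor_conn_map t) t' = - tractor_ip p t (tractor_conn_map t').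
Proof.
case: t => [[a Y] b]; case: t' => [[a' Y'] b'] /=.
rewrite -!scaleNr !(ipDl, ipDr, ipZl, ipZr) N_skew (ipC p kappa) (ipC p v Y).
by ring.
Qed.

End Derivation.
End DoubleTransport.

Section Isometries.
Context {R : realType}.

Section Rescale.
Variables (p n : nat) (h : R) (h0 : h != 0) (ups : 'rV[R]_n).

Lemma rescale_tractor_linear : linear (@rescale_tractor R p n h ups).
Proof.
move=> k [[a Y] b] [[a' Y'] b']; rewrite tractor_linE /= tractor_linE.
congr (_, _, _).
- by rewrite ipDl ipZl; ring.
- by rewrite scalerDr !scalerA scalerDl addrACA.
- by ring.
Qed.

Lemma rescale_tractor_isometry (t t' : tractor R n) :
  tractor_ip p (rescale_tractor (p := p) h ups t) (rescale_tractor (p := p) h ups t') =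
  tractor_ip p t t'.
Proof.
case: t => [[a Y] b]; case: t' => [[a' Y'] b'] /=.
by rewrite !(ipDl, ipDr, ipZl, ipZr) (ipC p ups Y'); field.
Qed.

Definition unscale_tractor (t : tractor R n) : tractor R n :=
  let: (a, Y, b) := t in
  let b' := (h * h)^-1 * b in
  let Y' := Y - b' *: ups in
  ((h * h) * a + ip p Y' ups + b' / 2 * ip p ups ups, Y', b').

Lemma unscale_tractorK t : rescale_tractor (p := p) h ups (unscale_tractor t) = t.
Proof.
case: t => [[a Y] b]; rewrite /unscale_tractor /=; congr (_, _, _).
- by field.
- by rewrite addrNK.
- by field.
Qed.

End Rescale.
End Isometries.

(** * The spinor module *)

Section SpinorModule.
Context {R : realType} {p q : nat} (S : spinor_module R p q).
Local Notation n := (p + q)%N.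
Implicit Types (u v : 'rV[R]_n) (z : spinor S).

Lemma clmx_linear a u v : clmx S (a *: u + v) = a%:C *: clmx S u + clmx S v.
Proof.
rewrite /clmx scaler_sumr -big_split; apply: eq_bigr => i _ /=.
by rewrite !mxE rmorphD rmorphM scalerDl scalerA.
Qed.

Lemma clmx_delta (a : 'I_n) : clmx S (delta_mx 0 a) = gamma S a.
Proof.
rewrite /clmx (bigD1 a) //= big1 ?addr0.
  by rewrite mxE !eqxx scale1r.
by move=> i ia; rewrite mxE eqxx (negPf ia) scale0r.
Qed.

Lemma clmx_clifford u v :
  clmx S u *m clmx S v + clmx S v *m clmx S u = (- 2 * ip p u v)%:C%:M.
Proof.
have E u' v' : clmx S u' *m clmx S v' =
    \sum_a \sum_b (u' 0 a * v' 0 b)%:C *: (gamma S a *m gamma S b).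
  rewrite /clmx mulmx_suml; apply: eq_bigr => a _.
  rewrite mulmx_sumr; apply: eq_bigr => b _.
  by rewrite -scalemxAl -scalemxAr scalerA -rmorphM.
rewrite (E u) (E v) [X in _ + X]exchange_big -big_split /=.
transitivity (\sum_(a < n) (- 2 * (eps p a * u 0 a * v 0 a))%:C%:M
                : 'M[R[i]]_(sdim S)).
  apply: eq_bigr => a _; rewrite -big_split /= (bigD1 a) //= big1 ?addr0.
    rewrite [v 0 a * _]mulrC -scalerDr gamma_clifford eqxx scale_scalar_mx -rmorphM.
    by congr (_%:C%:M); ring.
  move=> b ba; rewrite [v 0 b * _]mulrC -scalerDr gamma_clifford eq_sym (negPf ba).
  by rewrite mulr0 (rmorph0 (real_complex R)) scale_scalar_mx mulr0 raddf0.
by rewrite /ip mulr_sumr rmorph_sum raddf_sum.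
Qed.

Lemma cl_action : clifford_action (@ip R p n) (@cl _ _ _ S).
Proof.
split.
- by move=> z a u v; rewrite /cl clmx_linear mulmxDl scalemxAl.
- by move=> v a z z'; rewrite /cl mulmxDr scalemxAr.
- by move=> u v z; rewrite /cl !mulmxA -mulmxDl clmx_clifford mul_scalar_mx.
Qed.

Lemma cl_linear v : linear (cl v : spinor S -> spinor S).
Proof. exact: cact_lin cl_action v. Qed.

Lemma tractor_cl_double : @tractor_cl _ _ _ S = double_cl (@cl _ _ _ S).
Proof. by []. Qed.

End SpinorModule.

Section SpinGroup.
Context {R : realType} {p q : nat} (S : spinor_module R p q).
Local Notation n := (p + q)%N.
Local Notation vec := 'rV[R]_n.

Lemma scalar_mx_spinor_inj (a b : R) :
  (a%:C%:M : 'M[R[i]]_(sdim S)) = b%:C%:M -> a = b.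
Proof.
move/matrixP; have := sdim_gt0 S; case: (sdim S) => // m _ /(_ 0 0).
by rewrite !mxE eqxx !mulr1n => /(@complexI R).
Qed.

Lemma clmx_sqr (v : vec) : clmx S v *m clmx S v = (- ip p v v)%:C%:M.
Proof.
have E := clmx_clifford S v v.
have := congr1 (fun X : 'M[R[i]]_(sdim S) => (2^-1 : R)%:C *: X) E.
rewrite halfK scale_scalar_mx -rmorphM => ->.
by congr (_%:C%:M); rewrite mulNr mulrN mulrA mulVf ?mul1r // pnatr_eq0.
Qed.

Lemma spin_plus_unit (A : 'M[R[i]]_(sdim S)) : in_spin_plus A -> A \in unitmx.
Proof.
case=> s [s1 _ _ ->]; elim: s s1 => [_|v s IH] /=; first exact: unitmx1.
case/andP=> v1 /IH us; rewrite unitmx_mul us andbT.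
have : clmx S v *m ((- ip p v v)%:C *: clmx S v) = 1%:M.
  rewrite -scalemxAr clmx_sqr scale_scalar_mx -rmorphM.
  by case/orP: v1 => /eqP ->; rewrite !mulrNN mulr1 rmorph1.
by case/mulmx1_unit.
Qed.

Variables (A : 'M[R[i]]_(sdim S)) (l : 'M[R]_n).
Hypotheses (A_unit : A \in unitmx)
  (A_cover : forall v, A *m clmx S v = clmx S (v *m l) *m A).

(** Norms are read off Clifford squares, which [A] conjugates. *)
Lemma cover_norm (v : vec) : ip p (v *m l) (v *m l) = ip p v v.
Proof.
have E : A *m (clmx S v *m clmx S v) = clmx S (v *m l) *m clmx S (v *m l) *m A.
  by rewrite mulmxA A_cover -mulmxA A_cover mulmxA.
rewrite !clmx_sqr scalar_mxC in E.
by have /scalar_mx_spinor_inj/oppr_inj := can_inj (mulmxK A_unit) E.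
Qed.

Lemma cover_isometry (u v : vec) : ip p (u *m l) (v *m l) = ip p u v.
Proof.
have := cover_norm (u + v); rewrite mulmxDl !(ipDl, ipDr) !cover_norm.
rewrite (ipC p (v *m l)) (ipC p v u); lra.
Qed.

Lemma cover_unit : l \in unitmx.
Proof.
rewrite -row_free_unit; apply: inj_row_free => v vl0.
apply/rowP => a; rewrite mxE.
have := cover_isometry v (delta_mx 0 a); rewrite vl0 ip0l ip_delta.
by move/esym/(congr1 (fun r => eps p a * r)); rewrite mulrA eps_sqr mul1r mulr0.
Qed.

End SpinGroup.

Section FormActContr.
Context {R : realType} {p q : nat} (S : spinor_module R p q).
Local Notation n := (p + q)%N.
Local Notation tractor_contr :=
  (contr (fun j : 'I_n.+2 => eps p.+1 j) tractor_basis (@tractor_cl _ _ _ S)).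

Lemma tractor_form_act_contr d (w : seq (tractor R n) -> R) (z : spin_tractor S) :
    is_form d%:Z w ->
  tractor_form_act w z = ((d`!)%:R^-1 : R)%:C *: tractor_contr d w z.
Proof.
have ca := double_cl_action (cl_action S).
have anti (j k : 'I_n.+2) y : j != k ->
    tractor_cl (tractor_basis j) (tractor_cl (tractor_basis k) y) =
    - tractor_cl (tractor_basis k) (tractor_cl (tractor_basis j) y) :> spin_tractor S.
  move=> jk; apply/eqP; rewrite -addr_eq0 (cact_anti ca).
  by rewrite tractor_basis_orthogonal // mulr0 (rmorph0 (real_complex R)) scale0r.
move=> fw; rewrite -(form_act_contr _ (cact_lin ca) anti z fw).
rewrite scalerA -(rmorph_nat (real_complex R)) -rmorphM mulVf ?rmorph1 ?scale1r //.
Qed.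

(** The action is natural under an isometry [g] of tractors that is covered by a
    map [P] of spin tractors; [g'] is a section of [g]. *)
Lemma tractor_form_act_intertwine d (w w' : seq (tractor R n) -> R)
    (P : spin_tractor S -> spin_tractor S) (g g' : tractor R n -> tractor R n) z :
    is_form d%:Z w -> is_form d%:Z w' ->
    linear P -> (forall t z, P (tractor_cl t z) = tractor_cl (g t) (P z)) ->
    linear g -> (forall t t', tractor_ip p (g t) (g t') = tractor_ip p t t') ->
    (forall t, g (g' t) = t) -> (forall s, w' (map g s) = w s) ->
  P (tractor_form_act w z) = tractor_form_act w' (P z).
Proof.
move=> fw fw' lP Pc lg ig gK ww'.
have ca := double_cl_action (cl_action S).
have rb := @resolves_tractor_basis R p n (leq_addr q p).
rewrite !(tractor_form_act_contr _ (d := d)) // (linZ lP); congr (_ *: _).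
have rg := resolves_isometry rb lg ig gK.
exact: (contr_intertwine ca (@tractor_ipC _ p n) rb d z lP Pc rg (form_mlin fw') ww').
Qed.

End FormActContr.

Section TractorAction.
Context {R : realType} {p q : nat} {S : spinor_module R p q}.
Local Notation n := (p + q)%N.

Lemma tractor_form_act_components k (alpha : seq (tractor R n) -> R)
    (ap a0 amp am : seq 'rV[R]_n -> R) (phi1 phi2 : spinor S) (r : R[i]) :
    is_form k.+1%:Z alpha -> is_form k%:Z ap -> is_form k.+1%:Z a0 ->
    is_form (k%:Z - 1) amp -> is_form k%:Z am ->
    tractor_components alpha ap a0 amp am ->
  (tractor_form_act alpha ((phi1, - (r *: phi2)) : spin_tractor S)).1 =
  (2 * r) *: tangent_form_act ap phi2
  + (-1) ^+ k.+1 *: tangent_form_act amp phi1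
  + (-1) ^+ k.+1 *: tangent_form_act a0 phi1.
Proof.
move=> falpha fap fa0 famp fam comp.
have E1 : k%:Z = k.+1%:Z - 1 by lia.
have E2 : k%:Z - 1 = k.+1%:Z - 2 by lia.
rewrite E2 in famp; rewrite E1 in fap fam.
rewrite /tractor_form_act tractor_cl_double.
rewrite (components_act (cl_action S) _ _ falpha fap fa0 famp fam comp).
rewrite -(linear_opp_scale _ _ _ (form_act_linear _ _ (@cl_linear _ _ _ S) _)).
by [].
Qed.

End TractorAction.

(** * Calculus in a chart *)

Section Smoothness.
Context {R : realType} {n : nat}.
Variable O : set 'rV[R]_n.
Hypothesis openO : open O.
Implicit Types f g : 'rV[R]_n -> R.

Lemma near_open (P : 'rV[R]_n -> Prop) u : O u -> (forall y, O y -> P y) ->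
  \forall y \near u, P y.
Proof. by move=> Ou OP; apply: filterS OP _; exact: open_nbhs_nbhs. Qed.

Lemma Ck_eq k f g : (forall u, O u -> f u = g u) -> Ck k O f -> Ck k O g.
Proof.
elim: k f g => [|k IH] f g fg [fc fd].
- split=> // u Ou.
  have gf : {near u, f =1 g} by exact: near_open.
  rewrite /prop_for /continuous_at -(fg u Ou).
  exact: (cvg_trans (near_eq_cvg gf) (fc u Ou)).
- split=> [u Ou|v].
    have gf : {near u, f =1 g} by exact: near_open.
    rewrite /prop_for /continuous_at -(fg u Ou).
    exact: (cvg_trans (near_eq_cvg gf) (fc u Ou)).
  have [fv dfv] := fd v; split=> [u Ou|].
    have gf : {near u, f =1 g} by exact: near_open.
    exact: near_eq_derivable gf (fv u Ou).
  apply: IH dfv => u Ou; apply: near_eq_derive; exact: near_open.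
Qed.

Lemma CkS k f : Ck k.+1 O f -> Ck k O f.
Proof.
elim: k f => [|k IH] f [fc fd]; first by split.
by split=> // v; have [dv Cv] := fd v; split=> //; exact: IH.
Qed.

Lemma Ck_cst k (a : R) : Ck k O (fun=> a).
Proof.
have cc u : {for u, continuous (fun _ : 'rV[R]_n => a)} by exact: cst_continuous.
elim: k a cc => [|k IH] a cc; split=> // v; split=> [u _|].
  exact: derivable_cst.
have -> : (fun u => 'D_v (fun=> a) u) = fun _ : 'rV[R]_n => 0.
  by apply/funext => u; exact: derive_cst.
by apply: IH => u; exact: cst_continuous.
Qed.

Lemma CkD k f g : Ck k O f -> Ck k O g -> Ck k O (fun u => f u + g u).
Proof.
elim: k f g => [|k IH] f g [fc fd] [gc gd].
  by split=> // u Ou; exact: (continuousD (fc u Ou) (gc u Ou)).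
split=> [u Ou|v]; first exact: (continuousD (fc u Ou) (gc u Ou)).
have [[fv dfv] [gv dgv]] := (fd v, gd v); split=> [u Ou|].
  exact: (derivableD (fv u Ou) (gv u Ou)).
apply: Ck_eq (IH _ _ dfv dgv) => u Ou.
by rewrite -(deriveD (fv u Ou) (gv u Ou)).
Qed.

Lemma CkM k f g : Ck k O f -> Ck k O g -> Ck k O (fun u => f u * g u).
Proof.
elim: k f g => [|k IH] f g Cf Cg.
  case: Cf Cg => [fc fd] [gc gd].
  by split=> // u Ou; exact: (continuousM (fc u Ou) (gc u Ou)).
have [Cf' Cg'] := (CkS Cf, CkS Cg); case: Cf Cg => [fc fd] [gc gd].
split=> [u Ou|v]; first exact: (continuousM (fc u Ou) (gc u Ou)).
have [[fv dfv] [gv dgv]] := (fd v, gd v); split=> [u Ou|].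
  exact: (derivableM (fv u Ou) (gv u Ou)).
apply: Ck_eq (CkD (IH _ _ Cf' dgv) (IH _ _ Cg' dfv)) => u Ou.
exact: (esym (deriveM (fv u Ou) (gv u Ou))).
Qed.

Lemma smooth_cst (a : R) : smooth O (fun=> a).
Proof. by move=> k; exact: Ck_cst. Qed.

Lemma smoothD f g : smooth O f -> smooth O g -> smooth O (fun u => f u + g u).
Proof. by move=> sf sg k; exact: CkD. Qed.

Lemma smoothM f g : smooth O f -> smooth O g -> smooth O (fun u => f u * g u).
Proof. by move=> sf sg k; exact: CkM. Qed.

Lemma smooth_eq f g : (forall u, O u -> f u = g u) -> smooth O f -> smooth O g.
Proof. by move=> fg sf k; exact: Ck_eq (sf k). Qed.

Lemma smooth_derivable f u v : smooth O f -> O u -> derivable f u v.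
Proof. by move=> /(_ 1%N) [_ /(_ v) [dv _]] Ou; exact: dv. Qed.

End Smoothness.

Section Calculus.
Context {R : realType} {p q : nat} {S : spinor_module R p q}.
Context {M : topologicalType} {c : conformal_spin_manifold S M}.
Variables (sg : M -> R) (i : idx c).
Local Notation n := (p + q)%N.
Local Notation vec := 'rV[R]_n.
Implicit Types (f g : M -> R) (v : vec) (x y : M).

Local Notation O := (coord i @` dom i).

Lemma param_dom u : O u -> dom i (param i u).
Proof. by move=> [y iy <-]; rewrite coordK. Qed.

Lemma smooth_chart_eq f g : (forall y, dom i y -> f y = g y) ->
  smooth_chart i f -> smooth_chart i g.
Proof.
move=> fg; apply: smooth_eq => [|u Ou]; first exact: coord_open.
exact/fg/param_dom.
Qed.

Lemma smooth_chart_cst (a : R) : smooth_chart i (fun=> a).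
Proof. exact: smooth_cst. Qed.

Lemma smooth_chartD f g : smooth_chart i f -> smooth_chart i g ->
  smooth_chart i (fun y => f y + g y).
Proof. apply: smoothD; exact: coord_open. Qed.

Lemma smooth_chartM f g : smooth_chart i f -> smooth_chart i g ->
  smooth_chart i (fun y => f y * g y).
Proof. apply: smoothM; exact: coord_open. Qed.

Lemma smooth_chartN f : smooth_chart i f -> smooth_chart i (fun y => - f y).
Proof.
move=> sf; apply: smooth_chart_eq (smooth_chartM (smooth_chart_cst (-1)) sf).
by move=> y _; rewrite mulN1r.
Qed.

Section Derivative.
Variables (v : vec) (x : M).
Hypothesis ix : dom i x.

Let derivable_chart f w : smooth_chart i f -> derivable (f \o param i) (coord i x) w.
Proof. by move=> sf; apply: smooth_derivable sf _; exists x. Qed.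

(** The derivative is local, and [param i] maps a neighbourhood of [coord i x] into
    the domain. *)
Lemma dvec_eq f g : (forall y, dom i y -> f y = g y) ->
  dvec sg i v f x = dvec sg i v g x.
Proof.
move=> fg; apply: near_eq_derive; apply: (near_open (O := O)).
- exact: coord_open.
- by exists x.
- by move=> u Ou; exact/fg/param_dom.
Qed.

Lemma dvec_cst (a : R) : dvec sg i v (fun=> a) x = 0.
Proof. exact: derive_cst. Qed.

Lemma dvecD f g : smooth_chart i f -> smooth_chart i g ->
  dvec sg i v (fun y => f y + g y) x = dvec sg i v f x + dvec sg i v g x.
Proof.
move=> sf sg'.
pose w := v *m frame sg i x.
exact: (deriveD (derivable_chart (w := w) sf) (derivable_chart (w := w) sg')).
Qed.

Lemma dvecM f g : smooth_chart i f -> smooth_chart i g ->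
  dvec sg i v (fun y => f y * g y) x = f x * dvec sg i v g x + g x * dvec sg i v f x.
Proof.
move=> sf sg'.
pose w := v *m frame sg i x.
have := deriveM (derivable_chart (w := w) sf) (derivable_chart (w := w) sg').
by rewrite /= coordK.
Qed.

Lemma dvecN f : smooth_chart i f ->
  dvec sg i v (fun y => - f y) x = - dvec sg i v f x.
Proof.
move=> sf; rewrite (dvec_eq (g := fun y => -1 * f y)) => [|y _]; last by rewrite mulN1r.
by rewrite dvecM ?dvec_cst ?mulr0 ?addr0 ?mulN1r //; exact: smooth_chart_cst.
Qed.

End Derivative.

Definition csmooth (f : M -> R[i]) : Prop :=
  smooth_chart i (fun y => complex.Re (f y)) /\
  smooth_chart i (fun y => complex.Im (f y)).

Definition cdvec v (f : M -> R[i]) x : R[i] :=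
  Complex (dvec sg i v (fun y => complex.Re (f y)) x)
          (dvec sg i v (fun y => complex.Im (f y)) x).

Lemma csmooth_cst a : csmooth (fun=> a).
Proof. by split; exact: smooth_chart_cst. Qed.

Lemma csmooth_real f : smooth_chart i f -> csmooth (fun y => (f y)%:C).
Proof. by split=> //=; exact: smooth_chart_cst. Qed.

Lemma csmoothD (f g : M -> R[i]) : csmooth f -> csmooth g ->
  csmooth (fun y => f y + g y).
Proof.
move=> [f1 f2] [g1 g2]; split.
  by apply: smooth_chart_eq (smooth_chartD f1 g1) => y _; rewrite raddfD.
by apply: smooth_chart_eq (smooth_chartD f2 g2) => y _; rewrite raddfD.
Qed.

Lemma csmoothM (f g : M -> R[i]) : csmooth f -> csmooth g ->
  csmooth (fun y => f y * g y).
Proof.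
move=> [f1 f2] [g1 g2]; split.
  apply: smooth_chart_eq (smooth_chartD (smooth_chartM f1 g1)
    (smooth_chartN (smooth_chartM f2 g2))) => y _.
  by case: (f y) (g y) => ? ? [].
apply: smooth_chart_eq (smooth_chartD (smooth_chartM f1 g2) (smooth_chartM f2 g1)) => y _.
by case: (f y) (g y) => ? ? [].
Qed.

Section ComplexDerivative.
Variables (v : vec) (x : M).
Hypothesis ix : dom i x.

Lemma cdvec_eq (f g : M -> R[i]) : (forall y, dom i y -> f y = g y) ->
  cdvec v f x = cdvec v g x.
Proof. by move=> fg; congr (Complex _ _); apply: dvec_eq => // y iy; rewrite fg. Qed.

Lemma cdvec_cst a : cdvec v (fun=> a) x = 0.
Proof. by rewrite /cdvec !dvec_cst. Qed.

Lemma cdvec_real f : cdvec v (fun y => (f y)%:C) x = (dvec sg i v f x)%:C.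
Proof. by rewrite /cdvec /= dvec_cst. Qed.

Lemma cdvecD (f g : M -> R[i]) : csmooth f -> csmooth g ->
  cdvec v (fun y => f y + g y) x = cdvec v f x + cdvec v g x.
Proof.
move=> [f1 f2] [g1 g2].
rewrite -[RHS]/(Complex (_ + _) (_ + _)) -!dvecD //.
by congr (Complex _ _); apply: dvec_eq => // y _; rewrite raddfD.
Qed.

Lemma cdvecM (f g : M -> R[i]) : csmooth f -> csmooth g ->
  cdvec v (fun y => f y * g y) x = f x * cdvec v g x + g x * cdvec v f x.
Proof.
move=> [f1 f2] [g1 g2].
have [fg1 fg2] := (smooth_chartM f1 g1, smooth_chartM f2 g2).
have [fg3 fg4] := (smooth_chartM f1 g2, smooth_chartM f2 g1).
transitivity (Complex
  (dvec sg i v (fun y => complex.Re (f y) * complex.Re (g y)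
                         + - (complex.Im (f y) * complex.Im (g y))) x)
  (dvec sg i v (fun y => complex.Re (f y) * complex.Im (g y)
                         + complex.Im (f y) * complex.Re (g y)) x)).
  by congr (Complex _ _); apply: dvec_eq => // y _; case: (f y) (g y) => ? ? [].
rewrite !dvecD ?dvecN ?dvecM //; last exact: smooth_chartN.
rewrite /cdvec; case: (f x) (g x) => a b [a' b'] /=.
rewrite -[RHS]/(Complex (_ - _ + (_ - _)) (_ + _ + (_ + _))).
by congr (Complex _ _); ring.
Qed.

End ComplexDerivative.
End Calculus.

Section SpinorCalculus.
Context {R : realType} {p q : nat} {S : spinor_module R p q}.
Context {M : topologicalType} {c : conformal_spin_manifold S M}.
Variables (i : idx c).
Local Notation n := (p + q)%N.
Implicit Types (f : M -> R[i]) (phi chi : M -> spinor S) (x : M).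

Lemma smooth_spinor_eq phi chi : (forall y, dom i y -> phi y = chi y) ->
  smooth_spinor i phi -> smooth_spinor i chi.
Proof.
move=> E sphi m; have [s1 s2] := sphi m; split.
  by apply: smooth_chart_eq s1 => y iy; rewrite E.
by apply: smooth_chart_eq s2 => y iy; rewrite E.
Qed.

Lemma smooth_spinorD phi chi : smooth_spinor i phi -> smooth_spinor i chi ->
  smooth_spinor i (fun y => phi y + chi y).
Proof.
move=> s1 s2 m; have [t1 t2] := csmoothD (s1 m) (s2 m).
by split; [apply: smooth_chart_eq t1|apply: smooth_chart_eq t2] => y _; rewrite mxE.
Qed.

Lemma smooth_spinorZ f phi : csmooth i f -> smooth_spinor i phi ->
  smooth_spinor i (fun y => f y *: phi y).
Proof.
move=> s1 s2 m; have [t1 t2] := csmoothM s1 (s2 m).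
by split; [apply: smooth_chart_eq t1|apply: smooth_chart_eq t2] => y _; rewrite mxE.
Qed.

Lemma csmooth_sum (I : Type) (r : seq I) (F : I -> M -> R[i]) :
  (forall j, csmooth i (F j)) -> csmooth i (fun y => \sum_(j <- r) F j y).
Proof.
move=> sF; elim: r => [|j r IH].
  by under eq_fun do rewrite big_nil; exact: csmooth_cst.
by under eq_fun do rewrite big_cons; exact: csmoothD.
Qed.

Lemma smooth_spinor_mx (A : 'M[R[i]]_(sdim S)) phi : smooth_spinor i phi ->
  smooth_spinor i (fun y => A *m phi y : spinor S).
Proof.
move=> sphi m.
have [t1 t2] : csmooth i (fun y => \sum_j A m j * phi y j 0).
  by apply: csmooth_sum => j; apply: csmoothM (sphi j); exact: csmooth_cst.
by split; [apply: smooth_chart_eq t1|apply: smooth_chart_eq t2] => y _; rewrite mxE.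
Qed.

Section Derivative.
Variables (sg : M -> R) (v : 'rV[R]_n) (x : M).
Hypothesis ix : dom i x.

Lemma dspinorE phi m : dspinor sg i v phi x m 0 = cdvec sg i v (fun y => phi y m 0) x.
Proof. by rewrite mxE. Qed.

Lemma dspinor_eq phi chi : (forall y, dom i y -> phi y = chi y) ->
  dspinor sg i v phi x = dspinor sg i v chi x.
Proof.
by move=> E; apply/colP => m; rewrite !dspinorE; apply: cdvec_eq => // y iy; rewrite E.
Qed.

Lemma dspinorD phi chi : smooth_spinor i phi -> smooth_spinor i chi ->
  dspinor sg i v (fun y => phi y + chi y) x =
  dspinor sg i v phi x + dspinor sg i v chi x.
Proof.
move=> s1 s2; apply/colP => m; rewrite [RHS]mxE !dspinorE -cdvecD //.
by apply: cdvec_eq => // y _; rewrite mxE.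
Qed.

Lemma dspinorZ f phi : csmooth i f -> smooth_spinor i phi ->
  dspinor sg i v (fun y => f y *: phi y) x =
  cdvec sg i v f x *: phi x + f x *: dspinor sg i v phi x.
Proof.
move=> s1 s2; apply/colP => m.
rewrite [RHS]mxE [X in _ = X + _]mxE [X in _ = _ + X]mxE !dspinorE.
rewrite addrC [_ * phi x m 0]mulrC -cdvecM //.
by apply: cdvec_eq => // y _; rewrite mxE.
Qed.

Lemma cdvec_sum (I : Type) (r : seq I) (F : I -> M -> R[i]) :
    (forall j, csmooth i (F j)) ->
  cdvec sg i v (fun y => \sum_(j <- r) F j y) x = \sum_(j <- r) cdvec sg i v (F j) x.
Proof.
move=> sF; elim: r => [|j r IH].
  by under eq_fun do rewrite big_nil; rewrite big_nil cdvec_cst.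
under eq_fun do rewrite big_cons; rewrite big_cons cdvecD ?IH //.
exact: csmooth_sum.
Qed.

Lemma dspinor_mx (A : 'M[R[i]]_(sdim S)) phi : smooth_spinor i phi ->
  dspinor sg i v (fun y => A *m phi y : spinor S) x = A *m dspinor sg i v phi x.
Proof.
move=> sphi; apply/colP => m; rewrite [RHS]mxE dspinorE.
transitivity (cdvec sg i v (fun y => \sum_j A m j * phi y j 0) x).
  by apply: cdvec_eq => // y _; rewrite mxE.
have sA j : csmooth i (fun=> A m j) by exact: csmooth_cst.
rewrite cdvec_sum => [|j]; last exact: csmoothM.
apply: eq_bigr => j _; rewrite dspinorE cdvecM // cdvec_cst.
by rewrite mulr0 addr0.
Qed.

End Derivative.
End SpinorCalculus.

Section ContrLeibniz.
Context {R : realType} {V : lmodType R} {W : lmodType R[i]} {M : Type} {m : nat}.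
Variables (e : 'I_m -> R) (b : 'I_m -> V) (c : V -> W -> W).
Variables (smR : (M -> R) -> Prop) (smW : (M -> W) -> Prop).
Hypothesis smR_cst : forall a, smR (fun=> a).
Hypothesis smW0 : smW (fun=> 0).
Hypothesis smWD : forall F G, smW F -> smW G -> smW (fun y => F y + G y).
Hypothesis smWZ : forall f F, smR f -> smW F -> smW (fun y => (f y)%:C *: F y).
Hypothesis smWc : forall v F, smW F -> smW (fun y => c v (F y)).

Lemma smooth_sum (I : Type) (r : seq I) (F : I -> M -> W) :
  (forall i, smW (F i)) -> smW (fun y => \sum_(i <- r) F i y).
Proof.
move=> sF; elim: r => [|i r IH]; first by under eq_fun do rewrite big_nil.
by under eq_fun do rewrite big_cons; exact: smWD.
Qed.

Lemma contr_smooth d (w : M -> seq V -> R) (z : M -> W) :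
    (forall s, smR (w ^~ s)) -> smW z ->
  smW (fun y => contr e b c d (w y) (z y)).
Proof.
move=> + sz; elim: d w => [|d IH] w sw /=; first exact: smWZ.
apply: smooth_sum => i; apply: (smWZ (smR_cst _)); apply: smWc.
by apply: (IH (fun y => hook (b i) (w y))) => s; exact: sw.
Qed.

Variables (dR : (M -> R) -> R) (dW : (M -> W) -> W) (x : M).
Hypothesis dR_cst : forall a, dR (fun=> a) = 0.
Hypothesis dW0 : dW (fun=> 0) = 0.
Hypothesis dWD : forall F G, smW F -> smW G ->
  dW (fun y => F y + G y) = dW F + dW G.
Hypothesis dWZ : forall f F, smR f -> smW F ->
  dW (fun y => (f y)%:C *: F y) = (dR f)%:C *: F x + (f x)%:C *: dW F.
Hypothesis dWc : forall v F, smW F -> dW (fun y => c v (F y)) = c v (dW F).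
Hypothesis clin : forall v, linear (c v).

Lemma deriv_sum (I : Type) (r : seq I) (F : I -> M -> W) :
    (forall i, smW (F i)) ->
  dW (fun y => \sum_(i <- r) F i y) = \sum_(i <- r) dW (F i).
Proof.
move=> sF; elim: r => [|i r IH].
  by under eq_fun do rewrite big_nil; rewrite big_nil.
under eq_fun do rewrite big_cons.
by rewrite big_cons dWD ?IH //; exact: smooth_sum.
Qed.

(** The derivative acts on the coefficients of the form and on the spinor, the
    vectors of the frame having constant components. *)
Lemma contr_leibniz d (w : M -> seq V -> R) (z : M -> W) :
    (forall s, smR (w ^~ s)) -> smW z ->
  dW (fun y => contr e b c d (w y) (z y)) =
  contr e b c d (fun s => dR (w ^~ s)) (z x) + contr e b c d (w x) (dW z).
Proof.
move=> + sz; elim: d w => [|d IH] w sw /=; first exact: dWZ.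
have sh j : forall s, smR ((fun y => hook (b j) (w y)) ^~ s).
  by move=> s; exact: sw.
have sc j := contr_smooth d (sh j) sz.
rewrite deriv_sum => [|j]; last by apply: (smWZ (smR_cst _)); exact: smWc.
rewrite -big_split /=; apply: eq_bigr => j _.
rewrite (dWZ (smR_cst _) (smWc _ (sc j))) dR_cst scale0r add0r dWc // (IH _ (sh j)).
by rewrite (linD (clin _)) scalerDr.
Qed.

End ContrLeibniz.

Section SpinTractorCalculus.
Context {R : realType} {p q : nat} {S : spinor_module R p q}.
Context {M : topologicalType} {c : conformal_spin_manifold S M}.
Variables (i : idx c).
Local Notation n := (p + q)%N.
Implicit Types (psi : M -> spin_tractor S) (x : M).

Definition smooth_spin_tractor psi : Prop :=
  smooth_spinor i (fun y => (psi y).1) /\ smooth_spinor i (fun y => (psi y).2).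

Definition dspin_tractor (sg : M -> R) v psi x : spin_tractor S :=
  (dspinor sg i v (fun y => (psi y).1) x, dspinor sg i v (fun y => (psi y).2) x).

Lemma smooth_spinor0 : smooth_spinor i (fun=> 0 : spinor S).
Proof. by move=> m; exact: (csmooth_cst i). Qed.

Lemma dspinor0 sg v x : dspinor sg i v (fun=> 0 : spinor S) x = 0.
Proof.
apply/colP => m; rewrite dspinorE [RHS]mxE; exact: cdvec_cst.
Qed.

Lemma smooth_spinor_cl (Y : 'rV[R]_n) phi : smooth_spinor i phi ->
  smooth_spinor i (fun y => cl Y (phi y) : spinor S).
Proof. exact: smooth_spinor_mx. Qed.

Lemma smooth_tractor_cl t psi : smooth_spin_tractor psi ->
  smooth_spin_tractor (fun y => tractor_cl t (psi y)).
Proof.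
case: t => [[a Y] b] [s1 s2]; split.
  pose F y : spinor S := (-1 : R[i]) *: cl Y (psi y).1 + (- (2 * b)%:C) *: (psi y).2.
  have sF : smooth_spinor i F.
    apply: smooth_spinorD; apply: smooth_spinorZ (csmooth_cst i _) _ => //.
    exact: smooth_spinor_cl.
  apply: smooth_spinor_eq sF => y _; rewrite /F scaleN1r scaleNr.
  by case: (psi y).
pose F y : spinor S := cl Y (psi y).2 + a%:C *: (psi y).1.
have sF : smooth_spinor i F.
  apply: smooth_spinorD; first exact: smooth_spinor_cl.
  exact: smooth_spinorZ (csmooth_cst i _) _.
by apply: smooth_spinor_eq sF => y _; rewrite /F; case: (psi y).
Qed.

Lemma dspin_tractor_cl sg v x t psi : dom i x -> smooth_spin_tractor psi ->
  dspin_tractor sg v (fun y => tractor_cl t (psi y)) x =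
  tractor_cl t (dspin_tractor sg v psi x).
Proof.
move=> ix; case: t => [[a Y] b] [s1 s2]; rewrite /dspin_tractor; congr (_, _).
  pose F y : spinor S := (-1 : R[i]) *: cl Y (psi y).1 + (- (2 * b)%:C) *: (psi y).2.
  rewrite (dspinor_eq _ _ ix (chi := F)); last first.
    by move=> y _; rewrite /F scaleN1r scaleNr; case: (psi y).
  have sc := smooth_spinor_cl Y s1.
  rewrite dspinorD //; [|exact: smooth_spinorZ (csmooth_cst i _) _..].
  rewrite !(dspinorZ _ _ ix (csmooth_cst i _)) // !cdvec_cst !scale0r !add0r.
  by rewrite (dspinor_mx _ _ ix _ s1) scaleN1r scaleNr.
pose F y : spinor S := cl Y (psi y).2 + a%:C *: (psi y).1.
rewrite (dspinor_eq _ _ ix (chi := F)); last by move=> y _; rewrite /F; case: (psi y).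
rewrite dspinorD //; [|exact: smooth_spinor_cl|exact: smooth_spinorZ (csmooth_cst i _) _].
rewrite (dspinorZ _ _ ix (csmooth_cst i _)) // cdvec_cst scale0r add0r.
by rewrite (dspinor_mx _ _ ix _ s2).
Qed.

Local Notation tractor_contr :=
  (contr (fun j : 'I_n.+2 => eps p.+1 j) tractor_basis (@tractor_cl _ _ _ S)).

Lemma smooth_spin_tractor0 : smooth_spin_tractor (fun=> 0).
Proof. by split; exact: smooth_spinor0. Qed.

Lemma smooth_spin_tractorD psi chi : smooth_spin_tractor psi ->
  smooth_spin_tractor chi -> smooth_spin_tractor (fun y => psi y + chi y).
Proof. by move=> [s1 s2] [t1 t2]; split; exact: smooth_spinorD. Qed.

Lemma smooth_spin_tractorZ f psi : smooth_chart i f -> smooth_spin_tractor psi ->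
  smooth_spin_tractor (fun y => (f y)%:C *: psi y).
Proof.
by move=> /csmooth_real sf [s1 s2]; split; exact: smooth_spinorZ.
Qed.

Lemma smooth_tractor_contr d (alpha : M -> seq (tractor R n) -> R) psi :
    (forall s, smooth_chart i (alpha ^~ s)) -> smooth_spin_tractor psi ->
  smooth_spin_tractor (fun y => tractor_contr d (alpha y) (psi y)).
Proof.
apply: contr_smooth.
- exact: smooth_chart_cst.
- exact: smooth_spin_tractor0.
- exact: smooth_spin_tractorD.
- exact: smooth_spin_tractorZ.
- exact: smooth_tractor_cl.
Qed.

Section Derivative.
Variables (sg : M -> R) (v : 'rV[R]_n) (x : M).
Hypothesis ix : dom i x.

Lemma dspin_tractorD psi chi : smooth_spin_tractor psi -> smooth_spin_tractor chi ->
  dspin_tractor sg v (fun y => psi y + chi y) x =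
  dspin_tractor sg v psi x + dspin_tractor sg v chi x.
Proof. by move=> [s1 s2] [t1 t2]; congr (_, _); exact: dspinorD. Qed.

Lemma dspin_tractorZ f psi : smooth_chart i f -> smooth_spin_tractor psi ->
  dspin_tractor sg v (fun y => (f y)%:C *: psi y) x =
  (dvec sg i v f x)%:C *: psi x + (f x)%:C *: dspin_tractor sg v psi x.
Proof.
move=> /csmooth_real sf [s1 s2]; rewrite -(cdvec_real sg).
by rewrite /dspin_tractor !(dspinorZ _ _ ix sf).
Qed.

Lemma dspin_tractor_contr d (alpha : M -> seq (tractor R n) -> R) psi :
    (forall s, smooth_chart i (alpha ^~ s)) -> smooth_spin_tractor psi ->
  dspin_tractor sg v (fun y => tractor_contr d (alpha y) (psi y)) x =
  tractor_contr d (fun s => dvec sg i v (alpha ^~ s) x) (psi x)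
  + tractor_contr d (alpha x) (dspin_tractor sg v psi x).
Proof.
apply: (@contr_leibniz R _ (spin_tractor S) M _ (fun j : 'I_n.+2 => eps p.+1 j)
  tractor_basis (@tractor_cl _ _ _ S) (smooth_chart i) smooth_spin_tractor
  _ _ _ _ _ (fun f => dvec sg i v f x) (fun F => dspin_tractor sg v F x)).
- exact: smooth_chart_cst.
- exact: smooth_spin_tractor0.
- exact: smooth_spin_tractorD.
- exact: smooth_spin_tractorZ.
- exact: smooth_tractor_cl.
- exact: dvec_cst.
- by rewrite /dspin_tractor !dspinor0.
- exact: dspin_tractorD.
- exact: dspin_tractorZ.
- by move=> t F; exact: dspin_tractor_cl.
- exact: cact_lin (double_cl_action (cl_action S)).
Qed.

End Derivative.
End SpinTractorCalculus.

(** * The Levi-Civita connection and its spin lift *)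

Section Koszul.
Context {R : realType} (p n : nat) (C : 'I_n -> 'I_n -> 'I_n -> R).
Hypothesis C_anti : forall a b d, C a b d = - C b a d.

Let koszul (a b d : 'I_n) : R :=
  2^-1 * eps p d * (eps p d * C a b d - eps p a * C b d a + eps p b * C d a b).

(** The Koszul formula in a frame with structure constants [C] gives a metric
    connection. *)
Lemma koszul_skew (a b d : 'I_n) : eps p d * koszul a b d = - (eps p b * koszul a d b).
Proof.
rewrite /koszul (C_anti d a) (C_anti d b) (C_anti b a).
have E (r t : R) (k : 'I_n) : eps p k * (r * eps p k * t) = r * t.
  by rewrite mulrCA !mulrA -[r * _ * _]mulrA eps_sqr mulr1.
by rewrite !E; ring.
Qed.

(** The Koszul formula in a frame with structure constants [C] gives a torsion-free
    connection. *)
Lemma koszul_torsion (a b d : 'I_n) : koszul a b d - koszul b a d = C a b d.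
Proof.
rewrite /koszul (C_anti a d) (C_anti d b) (C_anti b a).
rewrite (_ : _ - _ = (2^-1 * 2) * (eps p d * eps p d) * C a b d); last by ring.
by rewrite eps_sqr mulr1 mulVf ?mul1r // pnatr_eq0.
Qed.

End Koszul.

Section SpinLift.
Context {R : realType} {p n : nat} {W : lmodType R[i]}.
Variable c : 'rV[R]_n -> W -> W.
Hypothesis ca : clifford_action (@ip R p n) c.
Variable C : 'M[R]_n.
Hypothesis C_skew : forall b d : 'I_n, eps p d * C b d = - (eps p b * C d b).

Let e (a : 'I_n) : 'rV[R]_n := delta_mx 0 a.
Let k (a b : 'I_n) : R := eps p a * C a b.

(** The image in the Clifford algebra of the matrix [C] of so(p,q). *)
Definition spin_lift (z : W) : W :=
  \sum_(a < n) \sum_(b < n | (a < b)%N)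
    (2^-1 * eps p a * C a b)%:C *: c (e a) (c (e b) z).

Let k_anti a b : k b a = - k a b.
Proof.
have E : C b a = - (eps p a * eps p b * C a b).
  by rewrite -[LHS]mul1r -(eps_sqr p a) -mulrA C_skew mulrN mulrA.
rewrite /k E (_ : _ * _ = - ((eps p b * eps p b) * (eps p a * C a b))); last by ring.
by rewrite eps_sqr mul1r.
Qed.

Let k_diag a : k a a = 0.
Proof. by have := k_anti a a; lra. Qed.

(** In the full sum each pair occurs twice, as the coefficient and the Clifford
    product both change sign. *)
Lemma spin_lift_full z :
  spin_lift z = \sum_a \sum_b (4^-1 * k a b)%:C *: c (e a) (c (e b) z).
Proof.
pose F a b := (4^-1 * k a b)%:C *: c (e a) (c (e b) z).
have F_sym a b : F a b = F b a.
  have [->//|ab] := eqVneq a b.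
  rewrite /F k_anti (cact_swap ca (e b)) ip_delta mxE (negPf ab).
  rewrite andbF !mulr0 (rmorph0 (real_complex R)) scale0r sub0r.
  by rewrite mulrN rmorphN scaleNr scalerN.
have F_diag a : F a a = 0 by rewrite /F k_diag mulr0 (rmorph0 (real_complex R)) scale0r.
rewrite /spin_lift.
transitivity (\sum_(a < n)
    (\sum_(b < n | (a < b)%N) F a b + \sum_(b < n | (b < a)%N) F a b)).
  rewrite big_split /= [X in _ + X](exchange_big_dep xpredT) //=.
  rewrite -big_split /=; apply: eq_bigr => a _.
  rewrite -big_split /=; apply: eq_bigr => b _.
  rewrite (F_sym b a) -scalerDl -rmorphD; congr (_%:C *: _).
  by rewrite /k -mulrDl (_ : 4^-1 + 4^-1 = 2^-1) ?mulrA //; field.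
apply: eq_bigr => a _.
rewrite [RHS](bigID (fun b : 'I_n => (a < b)%N)) /=; congr (_ + _).
rewrite [RHS](bigID (fun b => b == a)) /= [X in _ = X + _]big1 ?add0r; last first.
  by move=> b /andP[_ /eqP->]; exact: F_diag.
by apply: eq_bigl => b; rewrite -leqNgt -[b == a]/(b == a :> nat) ltn_neqAle andbC.
Qed.

(** The commutator of [c (e a) c (e b)] with [c Y] is
    2 <e_a, Y> c(e_b) - 2 <e_b, Y> c(e_a); the two halves of the sum are equal by
    skewness. *)
Lemma spin_lift_commutator Y z :
  spin_lift (c Y z) = c (Y *m C) z + c Y (spin_lift z).
Proof.
have cl := cact_lin ca; have cv z' := cact_vec ca z'.
rewrite !spin_lift_full (lin_sum (cl Y)).
transitivity (\sum_a \sum_b (2^-1 * (C a b * Y 0 a))%:C *: c (e b) z +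
  \sum_a \sum_b (- (2^-1 * (k a b * eps p b * Y 0 b)))%:C *: c (e a) z +
  \sum_a c Y (\sum_b (4^-1 * k a b)%:C *: c (e a) (c (e b) z))).
  rewrite -!big_split; apply: eq_bigr => a _ /=.
  rewrite (lin_sum (cl Y)) -!big_split; apply: eq_bigr => b _ /=.
  rewrite (cact_swap ca (e b) Y) (linD (cl (e a))) (linN (cl (e a))) (linZ (cl (e a))).
  rewrite (cact_swap ca (e a) Y) (linZ (cl Y)).
  rewrite (ipC p (e b)) (ipC p (e a)) !ip_delta.
  have E : C a b = eps p a * k a b by rewrite /k mulrA eps_sqr mul1r.
  rewrite E; linear_identity_by R[i] W ltac:(by field).
congr (_ + _).
have -> : c (Y *m C) z = \sum_b ((Y *m C) 0 b)%:C *: c (e b) z.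
  rewrite {1}[Y *m C]row_sum_delta (rlin_sum _ _ (cv z)); apply: eq_bigr => b _.
  by rewrite (rlinZ _ _ (cv z)).
rewrite [X in X + _]exchange_big -big_split /=; apply: eq_bigr => b _.
rewrite -big_split /= mxE rmorph_sum scaler_suml; apply: eq_bigr => a _.
rewrite -scalerDl -rmorphD; congr (_%:C *: _).
have -> : k b a * eps p a = - C a b.
  by rewrite k_anti /k mulNr mulrAC eps_sqr mul1r.
by field.
Qed.

End SpinLift.

Section Connection.
Context {R : realType} {p q : nat} {S : spinor_module R p q}.
Context {M : topologicalType} {c : conformal_spin_manifold S M}.
Variables (sg : M -> R) (i : idx c).
Local Notation n := (p + q)%N.
Local Notation vec := 'rV[R]_n.
Local Notation trac := (tractor R n).
Implicit Types (v w Y : vec) (x : M) (a b d : 'I_n).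

Lemma bracket_anti v w x : bracket sg i v w x = - bracket sg i w v x.
Proof.
rewrite /bracket -mulNmx; congr (_ *m _).
by apply/rowP => m; rewrite !mxE opprB.
Qed.

Lemma bracket_antiE v w x d : bracket sg i v w x 0 d = - bracket sg i w v x 0 d.
Proof. by rewrite bracket_anti [LHS]mxE. Qed.

Let bracket_coef x a b d := bracket sg i (e_ a) (e_ b) x 0 d.

Lemma christoffel_skew a b d x :
  eps p d * christoffel sg i a b d x = - (eps p b * christoffel sg i a d b x).
Proof.
apply: (koszul_skew p (C := bracket_coef x)) => a' b' d'; exact: bracket_antiE.
Qed.

Lemma christoffel_torsion a b d x :
  christoffel sg i a b d x - christoffel sg i b a d x =
  bracket sg i (e_ a) (e_ b) x 0 d.
Proof.
apply: (koszul_torsion p (C := bracket_coef x)) => a' b' d'; exact: bracket_antiE.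
Qed.

Lemma conn_skew v x b d :
  eps p d * conn sg i v x b d = - (eps p b * conn sg i v x d b).
Proof.
rewrite [conn _ _ _ _ b d]mxE [conn _ _ _ _ d b]mxE !mulr_sumr -sumrN.
apply: eq_bigr => a _; by rewrite mulrCA christoffel_skew mulrN mulrCA.
Qed.

Lemma conn_ip_skew v x Y Y' :
  ip p (Y *m conn sg i v x) Y' = - ip p Y (Y' *m conn sg i v x).
Proof.
rewrite /ip -sumrN.
transitivity (\sum_d \sum_b Y 0 b * Y' 0 d * (eps p d * conn sg i v x b d)).
  apply: eq_bigr => d _; rewrite [in LHS]mxE mulr_sumr mulr_suml.
  by apply: eq_bigr => b _; ring.
rewrite exchange_big; apply: eq_bigr => b _ /=.
rewrite [in RHS]mxE mulr_sumr -sumrN; apply: eq_bigr => d _.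
by rewrite conn_skew; ring.
Qed.

Lemma nabla_cst v Y x : nabla sg i v (fun=> Y) x = Y *m conn sg i v x.
Proof.
by rewrite /nabla (_ : \row_m _ = 0) ?add0r //; apply/rowP => m; rewrite !mxE dvec_cst.
Qed.

Lemma conn_e a b x : (e_ a *m conn sg i (e_ b) x) = \row_d christoffel sg i b a d x.
Proof.
apply/rowP => d; rewrite -rowE !mxE (bigD1 b) //= big1 ?addr0.
  by rewrite mxE !eqxx mul1r.
by move=> k kb; rewrite mxE eqxx (negPf kb) mul0r.
Qed.

Lemma nabla_torsion a b x :
  nabla sg i (e_ a) (fun=> e_ b) x - nabla sg i (e_ b) (fun=> e_ a) x =
  bracket sg i (e_ a) (e_ b) x.
Proof.
rewrite !nabla_cst !conn_e; apply/rowP => d.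
by rewrite [LHS]mxE [X in X + _]mxE [X in _ + X]mxE [X in _ - X]mxE christoffel_torsion.
Qed.

Lemma Kform_Ksharp v Y x : Kform sg i v Y x = ip p (Ksharp sg i v x) Y.
Proof.
have KE w : Kform sg i v w x = \sum_b (v *m K sg i x) 0 b * w 0 b.
  by rewrite /Kform mxE; apply: eq_bigr => b _; rewrite [w^T _ _]mxE.
rewrite {1}KE /ip; apply: eq_bigr => b _.
rewrite [Ksharp _ _ _ _ _ _]mxE mulrA eps_sqr mul1r KE (bigD1 b) //= big1 ?addr0.
  by rewrite [e_ b 0 b]mxE !eqxx mulr1.
by move=> k kb; rewrite [e_ b 0 k]mxE eqxx (negPf kb) mulr0.
Qed.

Lemma nabla_tractor_cst v (t : trac) x :
  nabla_tractor sg i v (fun=> t) x =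
  tractor_conn_map (p := p) v (Ksharp sg i v x) (mulmx^~ (conn sg i v x)) t.
Proof.
case: t => [[a Y] b]; rewrite /nabla_tractor /tractor_conn_map.
by rewrite /= nabla_cst !dvec_cst !add0r Kform_Ksharp.
Qed.

Lemma nabla_tractor_form_cst v (alpha : M -> seq trac -> R) x s :
  nabla_form sg i (nabla_tractor sg i v) v alpha x s =
  dvec sg i v (alpha^~ s) x -
  form_deriv (tractor_conn_map (p := p) v (Ksharp sg i v x) (mulmx^~ (conn sg i v x)))
    (alpha x) s.
Proof.
rewrite /nabla_form /form_deriv; congr (_ - _); apply: eq_bigr => l _.
by rewrite nabla_tractor_cst.
Qed.

Lemma spin_conn_commutator v x Y (z : spinor S) :
  spin_conn (c := c) sg i v x *m cl Y z =
  cl (Y *m conn sg i v x) z + cl Y (spin_conn (c := c) sg i v x *m z).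
Proof.
have E (z' : spinor S) : spin_conn (c := c) sg i v x *m z' =
    spin_lift (p := p) (@cl _ _ _ S) (conn sg i v x) z'.
  rewrite /spin_conn mulmx_suml; apply: eq_bigr => a _.
  rewrite mulmx_suml; apply: eq_bigr => b _.
  rewrite -scalemxAl /cl !clmx_delta mulmxA nabla_cst ip_delta -rowE.
  congr (_%:C *: _); rewrite [row _ _ _ _]mxE mulrA.
  by rewrite -[2^-1 * _ * _ * _]mulrA eps_sqr mulr1.
rewrite !E; apply: (spin_lift_commutator (cl_action S)); exact: conn_skew.
Qed.

End Connection.

(** * Clifford products of parallel sections *)

Section Parallel.
Context {R : realType} {p q : nat} {S : spinor_module R p q}.
Context {M : topologicalType} {c : conformal_spin_manifold S M}.
Variables (sg : M -> R) (i : idx c) (v : 'rV[R]_(p + q)) (x : M).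
Hypothesis ix : dom i x.
Local Notation n := (p + q)%N.
Local Notation trac := (tractor R n).
Local Notation tractor_contr :=
  (contr (fun j : 'I_n.+2 => eps p.+1 j) tractor_basis (@tractor_cl _ _ _ S)).

Let A := spin_conn_map (@cl _ _ _ S) v (Ksharp sg i v x)
  (fun z : spinor S => spin_conn (c := c) sg i v x *m z : spinor S).
Let L := tractor_conn_map (p := p) v (Ksharp sg i v x) (mulmx^~ (conn sg i v x)).

Lemma nabla_spin_tractorE (psi : M -> spin_tractor S) :
  nabla_spin_tractor sg i v psi x = dspin_tractor i sg v psi x + A (psi x).
Proof.
rewrite /nabla_spin_tractor /A /nabla_spinor /dspin_tractor /=.
by case: (psi x) => z1 z2 /=; rewrite pairD; congr (_, _); rewrite addrA.
Qed.

(** Parallelism of [alpha] turns the derivatives of its coefficients into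
    [form_deriv], and [contr_derivation] then moves the zeroth-order part of the
    connection through the action onto [psi]. *)
Lemma parallel_tractor_form_act d (alpha : M -> seq trac -> R)
    (psi : M -> spin_tractor S) :
    (forall y, dom i y -> is_form d%:Z (alpha y)) ->
    (forall s, smooth_chart i (alpha^~ s)) -> smooth_spin_tractor i psi ->
    (forall s, nabla_form sg i (nabla_tractor sg i v) v alpha x s = 0) ->
    nabla_spin_tractor sg i v psi x = 0 ->
  nabla_spin_tractor sg i v (fun y => tractor_form_act (alpha y) (psi y)) x = 0.
Proof.
move=> fa sa sp pa pp.
have ca := double_cl_action (cl_action S).
have lOm : linear (fun z : spinor S => spin_conn (c := c) sg i v x *m z : spinor S).
  by move=> a z z'; rewrite mulmxDr -scalemxAr.
have Om_c Y (z : spinor S) := spin_conn_commutator sg i v x Y z.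
have lA : linear A := spin_conn_map_linear (cl_action S) v (Ksharp sg i v x) lOm.
rewrite nabla_spin_tractorE (tractor_form_act_contr _ (fa x ix)) (linZ lA).
set k : R := (d`!)%:R^-1.
have -> : dspin_tractor i sg v (fun y => tractor_form_act (alpha y) (psi y)) x =
    k%:C *: dspin_tractor i sg v (fun y => tractor_contr d (alpha y) (psi y)) x.
  transitivity (dspin_tractor i sg v
      (fun y => k%:C *: tractor_contr d (alpha y) (psi y)) x).
    congr (_, _); apply: dspinor_eq => // y iy;
    by rewrite (tractor_form_act_contr _ (fa y iy)).
  have sk : smooth_chart i (fun=> k) by exact: smooth_chart_cst.
  rewrite (dspin_tractorZ _ _ ix sk (smooth_tractor_contr d sa sp)).
  by rewrite dvec_cst scale0r add0r.
rewrite -scalerDr (dspin_tractor_contr _ _ ix _ sa sp).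
have -> : tractor_contr d (fun s => dvec sg i v (alpha^~ s) x) (psi x) =
    tractor_contr d (form_deriv L (alpha x)) (psi x).
  apply: eq_contr => s; apply/eqP; rewrite -subr_eq0; apply/eqP.
  by rewrite -[RHS](pa s) nabla_tractor_form_cst.
have key : tractor_contr d (form_deriv L (alpha x)) (psi x)
    + A (tractor_contr d (alpha x) (psi x)) = tractor_contr d (alpha x) (A (psi x)).
  have rb := @resolves_tractor_basis R p n (leq_addr q p).
  have Ac := conn_map_derivation (cl_action S) v (Ksharp sg i v x) lOm Om_c.
  have skewL := tractor_conn_map_skew v (Ksharp sg i v x) (conn_ip_skew sg i v x).
  exact: (contr_derivation ca (@tractor_ipC _ p n) rb d (psi x) lA Ac skewL
            (form_mlin (fa x ix))).
rewrite addrAC key -(linD (contr_linear _ _ ca _ _)) addrC -nabla_spin_tractorE pp.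
by rewrite (lin0 (contr_linear _ _ ca _ _)) scaler0.
Qed.

End Parallel.

Section TractorFields.
Context {R : realType} {p q : nat} {S : spinor_module R p q}.
Context {M : topologicalType} {c : conformal_spin_manifold S M}.
Local Notation n := (p + q)%N.
Local Notation trac := (tractor R n).

Lemma smooth_tractor_form_act (i : idx c) d (alpha : M -> seq trac -> R)
    (psi : M -> spin_tractor S) :
    (forall y, dom i y -> is_form d%:Z (alpha y)) ->
    (forall s, smooth_chart i (alpha^~ s)) -> smooth_spin_tractor i psi ->
  smooth_spin_tractor i (fun y => tractor_form_act (alpha y) (psi y)).
Proof.
move=> fa sa sp.
have sk : smooth_chart i (fun=> (d`!)%:R^-1 : R) by exact: smooth_chart_cst.
have [s1 s2] := smooth_spin_tractorZ sk (smooth_tractor_contr d sa sp).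
split; [apply: smooth_spinor_eq s1 | apply: smooth_spinor_eq s2] => y iy.
  by rewrite (tractor_form_act_contr _ (fa y iy)).
by rewrite (tractor_form_act_contr _ (fa y iy)).
Qed.

Lemma respinE (sg sg' : M -> R) (i : idx c) x (z : spin_tractor S) :
  respin sg sg' i x z =
  rescale_spin (@cl _ _ _ S) (expR ((sg' x - sg x) / 2)) (ups sg sg' i x) z.
Proof. by case: z => z1 z2; rewrite /respin /rescale_spin mulNr expRN. Qed.

Lemma retractorE (sg sg' : M -> R) (i : idx c) x (t : trac) :
  retractor sg sg' i x t =
  rescale_tractor (p := p) (expR ((sg' x - sg x) / 2)) (ups sg sg' i x) t.
Proof.
case: t => [[a Y] b]; rewrite /retractor /rescale_tractor -expRD -expRN.
by have <- : sg' x - sg x = (sg' x - sg x) / 2 + (sg' x - sg x) / 2 by field.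
Qed.

(** Both compatibility conditions are cases of [tractor_form_act_intertwine], for
    the transition functions and for the changes of metric. *)
Lemma tractor_clifford_field k
    (alpha : (M -> R) -> idx c -> M -> seq trac -> R)
    (psi : (M -> R) -> idx c -> M -> spin_tractor S) :
    tractor_form (Posz k) alpha -> spin_tractor_field psi ->
  spin_tractor_field (tractor_clifford alpha psi).
Proof.
move=> [fa sa ca ra] [p1 p2 rp].
have sm sg i : conf_factor c sg ->
    smooth_spin_tractor i (fun y => tractor_clifford alpha psi sg i y).
  move=> sgc; apply: smooth_tractor_form_act (fa _ sgc i) (sa _ sgc i) _.
  by split; [case: (p1 _ sgc) | case: (p2 _ sgc)].
have cocycle sg i j x : conf_factor c sg -> dom i x -> dom j x ->
    tractor_clifford alpha psi sg i x =
    (spin i j x *m (tractor_clifford alpha psi sg j x).1,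
     spin i j x *m (tractor_clifford alpha psi sg j x).2).
  move=> sgc ix jx; rewrite /tractor_clifford.
  have Au := spin_plus_unit (spin_plus ix jx).
  have Ac := spin_cover ix jx.
  pose P (z : spin_tractor S) : spin_tractor S := (spin i j x *m z.1, spin i j x *m z.2).
  pose g (t : trac) : trac := (t.1.1, t.1.2 *m lam i j x, t.2).
  pose g' (t : trac) : trac := (t.1.1, t.1.2 *m invmx (lam i j x), t.2).
  have -> : psi sg i x = P (psi sg j x).
    have E1 : (psi sg i x).1 = spin i j x *m (psi sg j x).1.
      by case: (p1 _ sgc) => _; apply.
    have E2 : (psi sg i x).2 = spin i j x *m (psi sg j x).2.
      by case: (p2 _ sgc) => _; apply.
    by rewrite /P -E1 -E2; case: (psi sg i x).
  symmetry; rewrite -[LHS]/(P _).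
  apply: (tractor_form_act_intertwine (g := g) (g' := g') _ (fa _ sgc j x jx)
    (fa _ sgc i x ix)).
  - by move=> a [z1 z2] [y1 y2]; rewrite /P /= !mulmxDr -!scalemxAr.
  - move=> [[a Y] b] [z1 z2]; rewrite /P /g /tractor_cl /= /cl.
    by rewrite mulmxBr mulmxDr mulmxN -!scalemxAr !mulmxA Ac.
  - move=> r [[a Y] b] [[a' Y'] b']; rewrite /g tractor_linE /=.
    by rewrite mulmxDl -scalemxAl.
  - by move=> [[a Y] b] [[a' Y'] b']; rewrite /g /= (cover_isometry Au Ac).
  - move=> [[a Y] b]; rewrite /g /g' /=.
    by rewrite mulmxKV // (cover_unit Au Ac).
  - by move=> s; rewrite (ca _ sgc i j).
split.
- move=> sg sgc; split=> [i|i j x ix jx]; first by case: (sm _ i sgc).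
  by rewrite (cocycle _ _ _ _ sgc ix jx).
- move=> sg sgc; split=> [i|i j x ix jx]; first by case: (sm _ i sgc).
  by rewrite (cocycle _ _ _ _ sgc ix jx).
move=> sg sg' sgc sgc' i x ix; rewrite /tractor_clifford (rp _ _ sgc sgc' i x ix).
rewrite !respinE; set h := expR _; set u := ups _ _ _ _.
have h0 : h != 0 by rewrite gt_eqF // expR_gt0.
symmetry; apply: (tractor_form_act_intertwine (g := rescale_tractor (p := p) h u)
  (g' := unscale_tractor p h u) _ (fa _ sgc i x ix) (fa _ sgc' i x ix)).
- exact: rescale_spin_linear (cl_action S) _ _.
- exact: rescale_intertwine (cl_action S) _ h0 _.
- exact: rescale_tractor_linear.
- exact: rescale_tractor_isometry h0 _.
- exact: unscale_tractorK h0 _.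
- move=> s; rewrite -(ra _ _ sgc sgc' i x s ix); congr (alpha _ _ _ _).
  by apply: eq_map => t; rewrite retractorE.
Qed.

End TractorFields.

(** * Derivatives of the leading component *)

Section Components.
Context {R : realType} {p q : nat} {S : spinor_module R p q}.
Context {M : topologicalType} {c : conformal_spin_manifold S M}.
Variables (sg : M -> R) (i : idx c).
Local Notation n := (p + q)%N.
Local Notation vec := 'rV[R]_n.
Local Notation trac := (tractor R n).

Lemma wedge1_vanish (theta : trac -> R) (w : seq trac -> R) s :
  (forall Y, theta (tangent_tractor Y) = 0) -> wedge1 theta w (map tangent_tractor s) = 0.
Proof.
move=> t0; rewrite /wedge1 big1 // => l _.
by rewrite (nth_map 0) -?(size_map tangent_tractor) // t0 mulr0 mul0r.
Qed.

Lemma map_snd_tangent (s : seq vec) : [seq t.1.2 | t <- map tangent_tractor s] = s.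
Proof. by rewrite -map_comp map_id. Qed.

Lemma components_tangent (alpha : seq trac -> R) (ap a0 amp am : seq vec -> R) s :
  tractor_components alpha ap a0 amp am -> alpha (map tangent_tractor s) = a0 s.
Proof.
have zp Y : tractor_ip p s_plus (tangent_tractor Y : trac) = 0.
  by rewrite /= ip0l !(mul0r, mulr0, addr0).
have zm Y : tractor_ip p s_minus (tangent_tractor Y : trac) = 0.
  by rewrite /= ip0l !(mul0r, mulr0, addr0).
rewrite /tractor_components /= => ->.
by rewrite !wedge1_vanish // map_snd_tangent add0r !addr0.
Qed.

Lemma components_s_minus (alpha : seq trac -> R) (ap a0 amp am : seq vec -> R) s :
    mlin ap -> mlin a0 -> mlin amp -> mlin am ->
    tractor_components alpha ap a0 amp am ->
  alpha (s_minus :: s) =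
  ap [seq t.1.2 | t <- s]
  - wedge1 (tractor_ip p s_minus) (fun s => amp [seq t.1.2 | t <- s]) s.
Proof.
move=> lap la0 lamp lam /(components_hook 1 0 0); rewrite /tractor_components /= => comp.
have zero w s' : mlin w -> hook 0 w s' = 0 by move=> lw; exact: (mlin0 [::] s' lw).
rewrite -[LHS]/(hook s_minus alpha s) [LHS]comp !zero // mul0r !addr0 mul1r.
have wz theta (w : seq trac -> R) s' : (forall s, w s = 0) -> wedge1 theta w s' = 0.
  by move=> w0; rewrite /wedge1 big1 // => l _; rewrite w0 mulr0.
rewrite wz => [|s']; last by rewrite mul0r zero // oppr0 addr0.
rewrite wz => [|s']; last by rewrite wz // => s''; exact: zero.
rewrite add0r addr0; congr (_ + _).
rewrite -[RHS]mulN1r -wedge1Z; apply: eq_wedge1 => s'.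
by rewrite zero // oppr0 addr0.
Qed.

Lemma map_set_nth_snd (s : seq vec) l (t : trac) : (l < size s)%N ->
  [seq t.1.2 | t <- set_nth 0 (map tangent_tractor s) l t] = set_nth 0 s l t.1.2.
Proof.
move=> ls; rewrite !set_nthE size_map ls map_cat /= -map_take -map_drop.
by rewrite !map_snd_tangent.
Qed.

Lemma wedge1_set_nth (amp : seq vec -> R) (s : seq vec) l (t : trac) :
    (l < size s)%N ->
  wedge1 (tractor_ip p s_minus) (fun s => amp [seq t.1.2 | t <- s])
    (set_nth 0 (map tangent_tractor s) l t) = (-1) ^+ l * t.2 * amp (omit l s).
Proof.
move=> ls; rewrite /wedge1.
have sz : size (set_nth 0 (map tangent_tractor s) l t) = size s.
  by rewrite size_set_nth size_map (maxn_idPr ls).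
have ls' : (l < size (set_nth 0%R (map tangent_tractor s) l t))%N by rewrite sz.
rewrite (bigD1 (Ordinal ls')) //= big1 ?addr0 => [|m ml].
  rewrite nth_set_nth /= eqxx; congr (_ * _ * _).
    by case: t {sz ls'} => [[a Y] b]; rewrite /= ip0l mul1r mulr0 !addr0.
  rewrite /omit map_cat map_take map_drop map_set_nth_snd //.
  rewrite set_nthE ls take_cat drop_cat size_take ls ltnn subnn take0 cats0.
  by rewrite ltnNge leqnSn /= subSnn /= drop0.
rewrite nth_set_nth /=.
have -> : (m == l :> nat) = false by apply: contraNF ml => /eqP E; apply/eqP/val_inj.
have ms : (m < size s)%N by rewrite -sz.
by rewrite (nth_map 0) //= ip0l !(mulr0, mul0r, addr0).
Qed.

End Components.

Section ComponentDerivatives.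
Context {R : realType} {p q : nat} {S : spinor_module R p q}.
Context {M : topologicalType} {c : conformal_spin_manifold S M}.
Variables (sg : M -> R) (i : idx c).
Local Notation n := (p + q)%N.
Local Notation vec := 'rV[R]_n.
Local Notation trac := (tractor R n).
Variables (alpha : M -> seq trac -> R) (ap a0 amp am : M -> seq vec -> R).
Hypothesis comp : forall y, dom i y ->
  tractor_components (alpha y) (ap y) (a0 y) (amp y) (am y).
Variables (k : nat).
Hypothesis fap : forall y, dom i y -> is_form k%:Z (ap y).
Hypothesis fa0 : forall y, dom i y -> is_form k.+1%:Z (a0 y).
Hypothesis famp : forall y, dom i y -> is_form (k%:Z - 1) (amp y).
Hypothesis fam : forall y, dom i y -> is_form k%:Z (am y).
Variable x : M.
Hypothesis ix : dom i x.
Hypothesis pa : forall v s, nabla_form sg i (nabla_tractor sg i v) v alpha x s = 0.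

(** This is nabla alpha = 0 evaluated on s_-, Y_1, ..., Y_k.  The term in alpha_0
    comes from nabla_v s_- = v, and the term in alpha_-+ from the component
    - <v, Y> of nabla_v Y along s_+. *)
Lemma nabla_component v s :
  nabla_form sg i (nabla sg i v) v ap x s = a0 x (v :: s) + wedge1 (ip p v) (amp x) s.
Proof.
have lap y (iy : dom i y) := form_mlin (fap iy).
have la0 y (iy : dom i y) := form_mlin (fa0 iy).
have lamp y (iy : dom i y) := form_mlin (famp iy).
have lam y (iy : dom i y) := form_mlin (fam iy).
pose L := tractor_conn_map (p := p) v (Ksharp sg i v x) (mulmx^~ (conn sg i v x)).
have := pa v (s_minus :: map tangent_tractor s).
rewrite nabla_tractor_form_cst form_deriv_cons.
rewrite (dvec_eq _ _ ix (g := ap^~ s)) => [|y iy]; last first.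
  rewrite (components_s_minus _ _ _ _ _ (comp iy)); try by eauto.
  rewrite map_snd_tangent wedge1_vanish ?subr0 // => Y.
  by rewrite /= ip0l !(mul1r, mulr0, addr0, mul0r).
rewrite (_ : tractor_conn_map _ _ _ s_minus = tangent_tractor v); last first.
  rewrite /tractor_conn_map /s_minus /tangent_tractor !ip0r mul0mx.
  by rewrite add0r scale1r scale0r subr0 oppr0.
rewrite (components_tangent (v :: s) (comp ix)).
move/eqP; rewrite subr_eq0 /nabla_form => /eqP ->.
rewrite -addrA; congr (_ + _); rewrite /form_deriv size_map /wedge1 -sumrB.
apply: eq_bigr => l _.
rewrite /hook.
rewrite (components_s_minus _ (lap _ ix) (la0 _ ix) (lamp _ ix) (lam _ ix) (comp ix)).
rewrite map_set_nth_snd // wedge1_set_nth // (nth_map 0) //=.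
rewrite nabla_cst addrAC scale0r addr0 scale0r subr0 subrr add0r.
by rewrite mulrN mulNr opprK.
Qed.

(** In the contraction of [nabla_component], the operator
    w |-> sum_a eps_a (e_a hook (e_a^flat /\ w)) multiplies forms of degree k - 1
    by n - (k - 1). *)
Lemma codifferential_component s :
  codifferential sg i ap x s = - ((n%:R - k%:R + 1) * amp x s).
Proof.
rewrite /codifferential; congr (- _).
transitivity (\sum_(a < n)
    (amp x s - eps p a * wedge1 (ip p (e_ a)) (hook (e_ a) (amp x)) s)).
  apply: eq_bigr => a _; rewrite nabla_component (form_dup [::] _ _ (fa0 ix)) add0r.
  by rewrite wedge1_cons ip_delta mxE !eqxx mulrBr mulr1 mulrA eps_sqr mul1r.
rewrite sumrB sumr_const card_ord -[amp x s *+ _]mulr_natl.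
rewrite (_ : \sum_(a < n) _ = (size s)%:R * amp x s).
  have [E|E] := eqVneq (size s)%:Z (k%:Z - 1); last first.
    by rewrite (form_size (famp ix)) // !(mulr0, subr0).
  have -> : k = (size s).+1 by lia.
  by rewrite -natr1; ring.
under eq_bigr do rewrite /wedge1 mulr_sumr.
rewrite exchange_big mulr_natl -[in RHS](card_ord (size s)) -sumr_const.
apply: eq_bigr => l _.
transitivity ((-1) ^+ l * amp x (nth 0 s l :: omit l s)).
  rewrite {2}[nth 0 s l](resolves_delta p) (mlin_sum _ _ (form_mlin (famp ix))) mulr_sumr.
  apply: eq_bigr => a _; rewrite (mlinZ [::] _ _ _ (form_mlin (famp ix))).
  by rewrite /hook (ipC p (nth 0 s l)) /=; ring.
by rewrite (form_omit (famp ix)) // mulrA -expr2 -exprM mulnC exprM sqrrN !expr1n mul1r.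
Qed.

(** The alternation of [nabla_component].  Values on frame vectors determine the
    action of a form, and for frame vectors the bracket is the antisymmetric part
    of the connection. *)
Lemma ext_derivative_component (r : seq 'I_n) :
  ext_derivative sg i ap x (map e_ r) = k.+1%:R * a0 x (map e_ r).
Proof.
set s := map e_ r.
have basis l : (l < size s)%N -> exists a, nth 0 s l = e_ a.
  rewrite size_map => lr; case: r @s lr => [//|a r'] s lr.
  by exists (nth a (a :: r') l); rewrite (nth_map a).
pose D u v := nabla sg i u (fun=> v) x.
transitivity (\sum_(l < size s) (-1) ^+ l *
    nabla_form sg i (nabla sg i (nth 0 s l)) (nth 0 s l) ap x (omit l s)).
  rewrite /ext_derivative; under [RHS]eq_bigr do rewrite /nabla_form mulrBr.
  rewrite sumrB; congr (_ + _); rewrite (form_alternation _ D (fap ix)) opprK.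
  apply: eq_bigr => l _; apply: eq_bigr => m _.
  have [[a ->] [b ->]] := (basis l (ltn_ord l), basis m (ltn_ord m)).
  by rewrite /D nabla_torsion.
under eq_bigr do rewrite nabla_component mulrDr.
rewrite big_split /= (wedge1_alternation (theta := ip p)) ?addr0; last exact: ipC.
transitivity (\sum_(l < size s) a0 x s).
  apply: eq_bigr => l _; rewrite (form_omit (fa0 ix)) //.
  by rewrite mulrA -expr2 -exprM mulnC exprM sqrrN !expr1n mul1r.
rewrite sumr_const card_ord -[a0 x s *+ _]mulr_natl.
have [[->]//|E] := eqVneq (size s)%:Z k.+1%:Z.
by rewrite (form_size (fa0 ix)) // !mulr0.
Qed.

Lemma codifferential_act (r : R[i]) (z : spinor S) : (k <= n)%N ->
  (r / (n%:R - k%:R + 1)) *: tangent_form_act (codifferential sg i ap x) z =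
  - r *: tangent_form_act (amp x) z.
Proof.
move=> kn.
have -> : tangent_form_act (codifferential sg i ap x) z =
    (- (n%:R - k%:R + 1))%:C *: tangent_form_act (amp x) z.
  by apply: form_act_frame_scale => s; rewrite mulNr codifferential_component.
have N0 : (n%:R - k%:R + 1 : R[i]) != 0 by rewrite -natrB // natr1 pnatr_eq0.
rewrite scalerA (_ : (- _)%:C = - (n%:R - k%:R + 1)); last first.
  by rewrite !(rmorphN, rmorphD, rmorph_nat, rmorph1).
by rewrite mulrN -mulrA mulVf // mulr1.
Qed.

Lemma ext_derivative_act (r : R[i]) (z : spinor S) :
  (r / k.+1%:R) *: tangent_form_act (ext_derivative sg i ap x) z =
  r *: tangent_form_act (a0 x) z.
Proof.
have -> : tangent_form_act (ext_derivative sg i ap x) z =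
    (k.+1%:R)%:C *: tangent_form_act (a0 x) z.
  by apply: form_act_frame_scale => s; exact: ext_derivative_component.
by rewrite scalerA rmorph_nat -mulrA mulVf ?mulr1 // pnatr_eq0.
Qed.

End ComponentDerivatives.

(** * Twistor spinors *)

Section Twistor.
Context {R : realType} {p q : nat} {S : spinor_module R p q}.
Context {M : topologicalType} {c : conformal_spin_manifold S M}.
Local Notation n := (p + q)%N.

(** The first component of the parallel equation is nabla_v phi = v . chi; hence
    D phi = sum_a eps_a e_a . (e_a . chi) = - n chi. *)
Lemma parallel_twistor (psi : (M -> R) -> idx c -> M -> spin_tractor S) (sg : M -> R) :
    (0 < n)%N -> spin_tractor_field psi -> parallel_spin_tractor psi ->
    conf_factor c sg ->
  twistor_spinor sg (fun i x => (psi sg i x).1) /\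
  (forall i x, dom i x -> psi sg i x =
     ((psi sg i x).1,
      - ((n%:R)^-1 *: dirac_op sg i (fun y => (psi sg i y).1) x))).
Proof.
move=> n0 [p1 _ _] pp sgc.
have nC0 : (n%:R : R[i]) != 0 by rewrite pnatr_eq0 -lt0n.
have nablaE i x v : dom i x ->
    nabla_spinor sg i v (fun y => (psi sg i y).1) x = cl v (psi sg i x).2.
  move=> ix; have /(congr1 fst) /= := pp sg sgc i x v ix.
  by move/eqP; rewrite subr_eq0 => /eqP.
have diracE i x : dom i x ->
    dirac_op sg i (fun y => (psi sg i y).1) x = - (n%:R *: (psi sg i x).2).
  move=> ix; rewrite /dirac_op.
  under eq_bigr do rewrite nablaE // (cact_sqr (cl_action S)).
  transitivity (\sum_(a < n) - (psi sg i x).2).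
    apply: eq_bigr => a _; rewrite scalerA -rmorphM ip_delta mxE !eqxx mulr1.
    by rewrite mulrN eps_sqr rmorphN rmorph1 scaleN1r.
  by rewrite sumr_const card_ord mulNrn scaler_nat.
split; last first.
  move=> i x ix; rewrite diracE // scalerN opprK scalerA mulVf // scale1r.
  by case: (psi sg i x).
split=> [|i x v ix]; first exact: p1.
rewrite nablaE // diracE // (linN (@cl_linear _ _ _ S v)) (linZ (@cl_linear _ _ _ S v)).
by rewrite scalerN scalerA mulVf // scale1r subrr.
Qed.

End Twistor.

Local Close Scope complex_scope.

Theorem proposition24 (R : realType) (p q : nat) (S : spinor_module R p q)
    (M : topologicalType) (c : conformal_spin_manifold S M)
    (M_connected : connected [set: M]) (n_ge3 : (3 <= p + q)%N)
    (k : nat) (k_le_n : (k <= p + q)%N)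
    (alpha : (M -> R) -> idx c -> M -> seq (tractor R (p + q)) -> R)
    (psi : (M -> R) -> idx c -> M -> spin_tractor S)
    (alpha_form : tractor_form (Posz k.+1) alpha)
    (alpha_parallel : parallel_form alpha)
    (psi_field : spin_tractor_field psi)
    (psi_parallel : parallel_spin_tractor psi)
    (sg : M -> R) (sg_conf : conf_factor c sg)
    (ap a0 amp am : idx c -> M -> seq 'rV[R]_(p + q) -> R)
    (ap_form : tangent_form (Posz k) ap)
    (a0_form : tangent_form (Posz k.+1) a0)
    (amp_form : tangent_form (Posz k - 1) amp)
    (am_form : tangent_form (Posz k) am)
    (alpha_components : forall i x, dom i x ->
       tractor_components (alpha sg i x) (ap i x) (a0 i x) (amp i x) (am i x)) :
  let n : nat := (p + q)%N in
  let phi (i : idx c) (x : M) : spinor S := (psi sg i x).1 in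
  let alpha_phi (i : idx c) (x : M) : spinor S := (tractor_clifford alpha psi sg i x).1 in
  [/\ spin_tractor_field (tractor_clifford alpha psi)
        /\ parallel_spin_tractor (tractor_clifford alpha psi),
      twistor_spinor sg phi
        /\ (forall i x, dom i x ->
              psi sg i x = (phi i x, - (n%:R^-1 *: dirac_op sg i (phi i) x))),
      forall i x, dom i x -> alpha_phi i x =
        (2 / n%:R) *: tangent_form_act (ap i x) (dirac_op sg i (phi i) x)
        + (-1) ^+ k.+1 *: tangent_form_act (amp i x) (phi i x)
        + (-1) ^+ k.+1 *: tangent_form_act (a0 i x) (phi i x),
      forall i x, dom i x -> alpha_phi i x =
        (2 / n%:R) *: tangent_form_act (ap i x) (dirac_op sg i (phi i) x)
        + ((-1) ^+ k / (n%:R - k%:R + 1)) *: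
            tangent_form_act (codifferential sg i (ap i) x) (phi i x)
        + ((-1) ^+ k.+1 / k.+1%:R) *:
            tangent_form_act (ext_derivative sg i (ap i) x) (phi i x)
    & twistor_spinor sg alpha_phi].
Proof.
move=> n phi alpha_phi.
have n0 : (0 < p + q)%N by apply: leq_trans n_ge3.
have [fa sa _ _] := alpha_form.
have [p1 p2 _] := psi_field.
have clifford_field := tractor_clifford_field alpha_form psi_field.
have clifford_parallel : parallel_spin_tractor (tractor_clifford alpha psi).
  move=> sg' sgc' i x v ix.
  apply: (parallel_tractor_form_act ix (fa _ sgc' i) (sa _ sgc' i)).
  - by split; [case: (p1 _ sgc') | case: (p2 _ sgc')].
  - by move=> s; exact: alpha_parallel.
  - exact: psi_parallel.
have [phi_twistor psiE] := parallel_twistor n0 psi_field psi_parallel sg_conf.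
have [fap _ _] := ap_form; have [fa0 _ _] := a0_form.
have [famp _ _] := amp_form; have [fam _ _] := am_form.
have formula i x : dom i x -> alpha_phi i x =
    (2 / n%:R) *: tangent_form_act (ap i x) (dirac_op sg i (phi i) x)
    + (-1) ^+ k.+1 *: tangent_form_act (amp i x) (phi i x)
    + (-1) ^+ k.+1 *: tangent_form_act (a0 i x) (phi i x).
  move=> ix.
  rewrite /alpha_phi /tractor_clifford (psiE i x ix).
  exact: (tractor_form_act_components _ _ _ (fa _ sg_conf i x ix) (fap i x ix)
    (fa0 i x ix) (famp i x ix) (fam i x ix) (alpha_components i x ix)).
split.
- by split.
- by split.
- exact: formula.
- move=> i x ix; rewrite (formula i x ix).
  have pa v s : nabla_form sg i (nabla_tractor sg i v) v (alpha sg i) x s = 0.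
    exact: alpha_parallel.
  have comp := alpha_components i.
  rewrite (codifferential_act comp (fap i) (fa0 i) (famp i) (fam i) ix pa _ _ k_le_n).
  rewrite (ext_derivative_act comp (fap i) (fa0 i) (famp i) (fam i) ix pa).
  by rewrite exprS mulN1r.
- exact: (parallel_twistor n0 clifford_field clifford_parallel sg_conf).1.
Qed.
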